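(* Let $s$ be a positive integer. For every nonempty $s$-uniform hypergraph $H$ (i.e. with at least one edge), all $p_0<1$, and every $\varepsilon>0$, there exists a constant $L>0$ such that the following holds. Let $n$ be a positive integer and let $p\in(0,1)$ satisfy $Ln^{-1/m_s(H)}\le p\le p_0$. Let $X=N_H(G^{(s)}(n,p))$. Then, for every $\eta\in[0,1]$, $$(1-\varepsilon)\,\Phi_{n,p}^H(\eta+\varepsilon)\ \le\ -\log\Pr\big(X\le\eta\,\mathbb E[X]\big)\ \le\ (1+\varepsilon)\,\Phi_{n,p}^H\big((1-\varepsilon)\eta\big).$$
   Context: Write $[n]=\{1,\dots,n\}$. For $q:\binom{[n]}{s}\to[0,1]$, $G^{(s)}(n,q)$ is the random $s$-uniform hypergraph with vertex set $[n]$ in which each $e\in\binom{[n]}{s}$ is an edge independently with probability $q_e$; $G^{(s)}(n,p)$ is the case $q\equiv p$. $N_H(G)$ is the number of copies of $H$ in $G$ (subhypergraphs of $G$, not necessarily induced, isomorphic to $H$). For $p\in(0,1)$ and $q\in[0,1]$, $$i_p(q)=q\log\frac qp+(1-q)\log\frac{1-q}{1-p},$$ with natural logarithms and $0\log 0=0$. For real $\eta$, $$\Phi_{n,p}^H(\eta)=\min\Big\{\sum_{e\in\binom{[n]}{s}}i_p(q_e):\ q\in[0,1]^{\binom{[n]}{s}},\ \mathbb E\big[N_H(G^{(s)}(n,q))\big]\le\eta\cdot\mathbb E\big[N_H(G^{(s)}(n,p))\big]\Big\},$$ where the minimum over an empty set is $+\infty$. The $s$-density $m_s(H)$ is $\max\big\{\frac{e_F-1}{v_F-s}:F\subseteq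 H,\ e_F\ge2\big\}$ if $H$ has at least two edges ($F$ ranges over subhypergraphs, with $v_F$ vertices and $e_F$ edges), and $m_s(H)=\frac1s$ otherwise. *)

(* Defs.v *)
From HB Require Import structures.
From mathcomp Require Import all_boot all_order all_algebra.
From mathcomp Require Import all_classical all_reals all_analysis.
Set Implicit Arguments.
Unset Strict Implicit.
Unset Printing Implicit Defensive.
Import Order.TTheory GRing.Theory Num.Theory numFieldNormedType.Exports.
Local Open Scope classical_set_scope.
Local Open Scope ring_scope.

Definition edge (s : nat) (T : finType) := {e : {set T} | #|e| == s}.

Definition everts (s : nat) (T : finType) (e : edge s T) : {set T} := sval e.

(* An s-uniform hypergraph is given by its finite vertex type T and its edges;
   every element of T is a vertex, so isolated vertices are allowed. *)
Definition hypergraph (s : nat) (T : finType) := {set edge s T}.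

(* F = (vertex set, edge set). *)
Definition subhypergraph (s : nat) (T : finType) (G : hypergraph s T)
    (F : {set T} * {set edge s T}) : bool :=
  (F.2 \subset G) && [forall e in F.2, everts e \subset F.1].

Definition isomorphic_to (s : nat) (V T : finType) (H : hypergraph s V)
    (F : {set T} * {set edge s T}) : bool :=
  [exists f : {ffun V -> T},
    [&& injectiveb f, f @: [set: V]%SET == F.1 &
        [set everts e | e in F.2]%SET ==
          [set f @: everts e | e in H]%SET]].

Definition copies (s : nat) (V T : finType) (H : hypergraph s V)
    (G : hypergraph s T) : nat :=
  #|[set F | subhypergraph G F && isomorphic_to H F]%SET|.

(* In the first branch every term is positive: two distinct s-sets lie in F.1,
   so #|F.1| > s; hence the initial value 0 of the maximum is harmless. *)
Definition s_density (R : realType) (s : nat) (V : finType)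
    (H : hypergraph s V) : R :=
  if (2 <= #|H|)%N then
    \big[Num.max/0]_(F : {set V} * {set edge s V} |
        subhypergraph H F && (2 <= #|F.2|)%N)
      ((#|F.2|%:R - 1) / (#|F.1|%:R - s%:R))
  else s%:R^-1.

Section RandomHypergraph.
Context {R : realType} {s : nat} {T : finType}.
Implicit Types q : edge s T -> R.

Definition hg_weight q (G : hypergraph s T) : R :=
  \prod_(e : edge s T) (if e \in G then q e else 1 - q e).

Definition hg_prob q (A : pred (hypergraph s T)) : R :=
  \sum_(G | A G) hg_weight q G.

Definition hg_expect q (X : hypergraph s T -> R) : R :=
  \sum_G hg_weight q G * X G.

End RandomHypergraph.

(* The convention 0 * log 0 = 0 holds because ln is total. *)
Definition rel_entropy (R : realType) (p q : R) : R :=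
  q * ln (q / p) + (1 - q) * ln ((1 - q) / (1 - p)).

Section Phi.
Context {R : realType} {s : nat} {V : finType}.
Variable (H : hypergraph s V).

Definition mean_copies (n : nat) (q : edge s 'I_n -> R) : R :=
  hg_expect q (fun G => (copies H G)%:R).

Definition feasible (n : nat) (p eta : R) : set (edge s 'I_n -> R) :=
  [set q | (forall e, 0 <= q e <= 1) /\
           mean_copies q <= eta * mean_copies (fun _ : edge s 'I_n => p)].

(* The infimum is attained as soon as the feasible set is nonempty (Phi_min
   below), and it is +oo otherwise. *)
Definition Phi (n : nat) (p eta : R) : \bar R :=
  ereal_inf [set (\sum_e rel_entropy p (q e))%:E | q in @feasible n p eta].

End Phi.
Arguments feasible {R s V} H n p eta.

Section Phi_min.
Context {R : realType}.

Lemma continuous_xlnx : continuous (fun x : R => x * ln x).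
Proof.
move=> x; case: (ltrgtP x 0) => [x0|x0|->].
- apply: (near_cst_continuous 0); near=> y.
  have y0 : y < 0 by near: y; exact: lt_nbhsl.
  by rewrite ln0 ?mulr0// ltW.
- by apply: cvgM; [exact: cvg_id|exact: continuous_ln].
- have b (y : R) : y < 1 -> `|y * ln y| <= 2 * Num.sqrt y.
    move=> y1; have [y0|y0] := leP y 0.
      by rewrite ln0// mulr0 normr0 mulr_ge0 ?sqrtr_ge0.
    have sy0 : 0 < Num.sqrt y by rewrite sqrtr_gt0.
    have Ey : y = Num.sqrt y ^+ 2 by rewrite sqr_sqrtr ?ltW.
    have lny : ln y = - (2 * ln (Num.sqrt y)^-1).
      by rewrite lnV ?posrE// {1}Ey lnXn// mulrN opprK mulr_natl.
    have sV : 1 <= (Num.sqrt y)^-1.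
      rewrite invf_ge1// -(@sqrtr1 R) ler_wsqrtr//; exact: ltW.
    rewrite normrM (gtr0_norm y0) lny normrN ger0_norm; last first.
      by rewrite mulr_ge0// ln_ge0.
    rewrite mulrCA ler_pM2l// {1}Ey expr2 -mulrA -[leRHS]mulr1.
    rewrite ler_pM2l// mulrC -ler_pdivlMr// mul1r.
    by apply/ltW/ln_sublinear; rewrite invr_gt0.
  rewrite /continuous_at mul0r; apply/norm_cvg0P.
  apply: (@squeeze_cvgr _ _ _ _ (fun=> 0) (fun y => 2 * Num.sqrt y)).
  + near=> y; rewrite normr_ge0 /=; apply: b.
    by near: y; exact: lt_nbhsl.
  + exact: cvg_cst.
  + have : 2 * Num.sqrt y @[y --> (0 : R)] --> 2 * Num.sqrt (0 : R).
      by apply: cvgM; [exact: cvg_cst|exact: sqrt_continuous].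
    by rewrite sqrtr0 mulr0.
Unshelve. all: by end_near. Qed.

Lemma continuous_rel_entropy (p : R) : 0 < p < 1 ->
  continuous (rel_entropy p).
Proof.
case/andP=> p0 p1.
have p10 : 0 < 1 - p by rewrite subr_gt0.
have E : rel_entropy p = fun q => p * ((q / p) * ln (q / p)) +
    (1 - p) * (((1 - q) / (1 - p)) * ln ((1 - q) / (1 - p))).
  apply/funext => q; rewrite /rel_entropy (mulrA p) (mulrA (1 - p)).
  by rewrite !(mulrC _ (_ / _)) !divfK ?gt_eqF.
rewrite E => q; apply: cvgD; apply: cvgM; try exact: cvg_cst.
- apply: (@continuous_comp _ _ _ (fun q : R => q / p) (fun x : R => x * ln x)).
    by apply: cvgM; [exact: cvg_id|exact: cvg_cst].
  exact: continuous_xlnx.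
- apply: (@continuous_comp _ _ _ (fun q : R => (1 - q) / (1 - p))
    (fun x : R => x * ln x)); last exact: continuous_xlnx.
  apply: cvgM; last exact: cvg_cst.
  by apply: cvgB; [exact: cvg_cst|exact: cvg_id].
Qed.

Lemma Phi_min (s : nat) (V : finType) (H : hypergraph s V) (n : nat)
    (p eta : R) : 0 < p < 1 -> feasible H n p eta !=set0 ->
  exists2 q, feasible H n p eta q &
    Phi H n p eta = (\sum_e rel_entropy p (q e))%:E /\
    forall q', feasible H n p eta q' ->
      \sum_e rel_entropy p (q e) <= \sum_e rel_entropy p (q' e).
Proof.
move=> p01 F0.
pose I := edge s 'I_n.
pose T : topologicalType := {ptws I -> R}.
have ev (e : I) : continuous (fun q : T => q e).
  exact: (@proj_continuous I (fun=> R) e).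
have cw (G : hypergraph s 'I_n) : continuous (fun q : T => hg_weight q G).
  rewrite /hg_weight; apply: (continuous_big (@mul_continuous R)) => e _.
  case: (e \in G); first exact: ev.
  have c1 : continuous (fun x : R => 1 - x).
    by move=> x; apply: cvgB; [exact: cvg_cst|exact: cvg_id].
  by move=> q; exact: (continuous_comp (ev e q) (c1 _)).
have addc : continuous (fun z : R * R => z.1 + z.2).
  by move=> z; apply: cvgD; [exact: cvg_fst|exact: cvg_snd].
have cm : continuous (fun q : T => mean_copies H q).
  rewrite /mean_copies /hg_expect.
  apply: (continuous_big addc) => G _ q.
  exact: (continuous_comp (cw G q) (@mulrr_continuous _ (copies H G)%:R _)).
have cr : continuous (fun q : T => \sum_e rel_entropy p (q e)).
  apply: (continuous_big addc) => e _ q.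
  apply: (@continuous_comp T R R (fun q => q e) (rel_entropy p) q (ev e q)).
  exact: (continuous_rel_entropy p01).
have cF : @compact T (feasible H n p eta).
  have := @compact_closedI T _
    [set q | mean_copies H q <= eta * mean_copies H (fun _ : I => p)]
    (@tychonoff I (fun=> R) (fun=> `[0, 1]%classic) (fun=> @segment_compact _ _ _)).
  set A := (X in compact (X `&` _)).
  rewrite /feasible.
  have -> : A = [set q : T | forall e, 0 <= q e <= 1].
    by apply/seteqP; split=> q /= h e; have := h e; rewrite /= in_itv.
  apply.
  have cl := @closed_le R (eta * mean_copies H (fun _ : I => p)).
  exact: (@preimage_closed T R (fun q => mean_copies H q) _ (fun q _ => cm q) cl).
have [q qF qm] := @compact_EVT_min T R _ _ F0 cF (continuous_subspaceT cr).
rewrite inE in qF; exists q => //.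
have m q' : feasible H n p eta q' ->
    \sum_e rel_entropy p (q e) <= \sum_e rel_entropy p (q' e).
  by move=> h; apply: qm; rewrite inE.
split=> //; apply/eqP; rewrite eq_le; apply/andP; split.
- by apply: ereal_inf_lbound; exists q.
- by apply: le_ereal_inf_tmp => _ [q' h <-]; rewrite lee_fin m.
Qed.

End Phi_min.

(* Main.v *)
Require Import Defs.
From mathcomp Require Import all_boot all_order all_algebra.
From mathcomp Require Import all_classical all_reals all_analysis.
From mathcomp Require Import fingroup perm ring lra zify.

(** Fix an enumeration of the [r] edges of [H] and count embeddings of [H]
    instead of copies: the two differ by the constant factor |Aut(H)|
    ([copies_embeddings]).  Let [I] be the set of embeddings, [E] the set of
    possible edges, [M = |I| p^r] the mean count, and let [A] be the event that
    the count is at most [eta M].  It is decreasing, and that is the only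
    property of [A] used below besides the bound on the count.

    Upper bound on - log P(A).  Let [q] have mean count at most
    [(1 - eps) eta M]; capping [q] at [p] keeps this and lowers the cost, so
    [q <= p].  Under [q] the event [A] has probability at least [eps] (Markov).
    The log-likelihood ratio of [q] against [p] has mean
    [Phi = sum_e i_p(q_e)] and variance O(p |E|), while [Phi] is at least a
    constant times [p |E|] because a deficit in the count forces a linear
    deficit of density ([entropy_ge_volume]).  Hence Chebyshev and a change of
    measure ([neg_ln_prob_le]) give - log P(A) <= (1 + eps) Phi as soon as
    [p |E|] is large.

    Lower bound on - log P(A).  Let [mu] be the law conditioned on [A].  For a set
    [W] of exposed edges, the posterior [post W e] is the [mu]-probability of [e]
    given the trace on [W]; it is at most [p] because [A] is decreasing.  The product
    measure sought is given by [p] on [W] and the posteriors off [W], for a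
    suitable small [W] and a suitable trace.

    - Its cost is right on average: for every [W], the [mu]-mean of
      [sum_(e notin W) i_p(post W e)] is at most - log P(A) ([post_entropy]).
    - Its count is right on average.  Colour the edges at random with [K]
      colours, and let [W] consist of the colours below [j].  The mean squared
      posterior of an edge can only grow with [j] and is at most [p^2], so
      exposing [r] further colours hardly changes it for a suitable [j]
      ([exists_stable_level]); by orthogonality the posteriors themselves
      hardly change in L^2.  For an embedding whose edges have the colours
      j, j+1, ..., j+r-1, replace the indicators of the edges by posteriors
      one at a time, each one when the previous colours are exposed
      ([prod_telescope], [rainbow_gap_le]).  By Cauchy-Schwarz, in the weighted
      form [mul_le_avg_sq], the error is
      the small L^2 change times the second moment of a degree, and the
      latter is bounded by counting pairs of embeddings that share edges
      ([exposed_degree_second_moment]).  The lower bound on [p] is at its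
      most important here: each sharing pattern [F] is rare, since
      [n^(v_F - s) p^(e_F - 1)] is large ([density_threshold]).
      Colours from [j] on are exchangeable, so the bound for these
      embeddings transfers to all those avoiding [W]
      ([sum_avoiding_rainbow]), and few embeddings meet [W], as [j / K] is
      small.

    One linear functional combines the two errors, so a single pair of a
    colouring and a trace is good for both ([exists_product_approximation]). *)

Set Implicit Arguments.
Unset Strict Implicit.
Unset Printing Implicit Defensive.
Import Order.TTheory GRing.Theory Num.Theory.
Local Open Scope ring_scope.

(** * Relative entropy of Bernoulli variables *)

Section Entropy.
Context {R : realType}.
Implicit Types p q x : R.

Lemma ln_le_subr1 x : 0 < x -> ln x <= x - 1.
Proof.
by move=> x0; rewrite -{1}(subrKC 1 x); apply: le_ln1Dx; lra.
Qed.

Lemma subVr_le_ln x : 0 < x -> 1 - x^-1 <= ln x.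
Proof.
move=> x0; have := @ln_le_subr1 x^-1; rewrite invr_gt0 lnV ?posrE//.
by move=> /(_ x0); lra.
Qed.

Lemma rel_entropy_self p : 0 < p < 1 -> rel_entropy p p = 0.
Proof.
move=> /andP[p0 p1]; rewrite /rel_entropy !divff ?ln1 ?mulr0 ?addr0//; lra.
Qed.

Lemma mul_ln_ge p q : 0 < p -> 0 <= q -> q - p <= q * ln (q / p).
Proof.
move=> p0; rewrite le_eqVlt => /orP[/eqP<-|q0]; first by rewrite mul0r; lra.
have := @subVr_le_ln (q / p); rewrite divr_gt0// => /(_ isT).
rewrite -(ler_pM2l q0) invf_div mulrBr mulr1 => h.
by apply: le_trans h; rewrite mulrCA divff ?mulr1//; lra.
Qed.

Lemma rel_entropy_ge0 p q : 0 < p < 1 -> 0 <= q <= 1 -> 0 <= rel_entropy p q.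
Proof.
move=> /andP[p0 p1] /andP[q0 q1]; rewrite /rel_entropy.
have := mul_ln_ge p0 q0.
by have := @mul_ln_ge (1 - p) (1 - q); rewrite subr_gt0 subr_ge0 => /(_ p1 q1); lra.
Qed.

(** The bound [1 - 1/y <= ln y] at [y = sqrt x], rather than at [x], yields
    [(1 - sqrt x)^2], which is of second order at [x = 1]. *)
Lemma mul_ln_quadratic x : 0 < x <= 1 -> (1 - x) ^+ 2 / 4 <= x * ln x + 1 - x.
Proof.
move=> /andP[x0 x1].
have s0 : 0 < Num.sqrt x by rewrite sqrtr_gt0.
have Ex : x = Num.sqrt x ^+ 2 by rewrite sqr_sqrtr// ltW.
have s1 : Num.sqrt x <= 1 by rewrite -(@sqrtr1 R) ler_wsqrtr.
move: (Num.sqrt x) s0 Ex s1 => y y0 -> y1.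
rewrite lnXn//.
have := subVr_le_ln y0; rewrite -(ler_pM2l y0) mulrBr divff ?gt_eqF// => h.
have h1 : y ^+ 2 * (ln y *+ 2) >= 2 * y * (y - 1).
  have -> : y ^+ 2 * (ln y *+ 2) = 2 * y * (y * ln y) by rewrite mulr2n; ring.
  by rewrite ler_pM2l ?mulr_gt0//; lra.
have h2 : (1 - y) ^+ 2 * (1 + y) ^+ 2 <= (1 - y) ^+ 2 * 4.
  by rewrite ler_wpM2l ?sqr_ge0//; nra.
have -> : (1 - y ^+ 2) ^+ 2 = (1 - y) ^+ 2 * (1 + y) ^+ 2 by ring.
lra.
Qed.

(** The denominator is of order [p], not 1: this makes the cost of lowering a
    positive proportion of the density comparable with the mean number of edges. *)
Lemma rel_entropy_quadratic p q : 0 < p < 1 -> 0 <= q <= p ->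
  (p - q) ^+ 2 / (4 * p) <= rel_entropy p q.
Proof.
move=> /andP[p0 p1] /andP[q0 qp]; rewrite /rel_entropy.
have := @mul_ln_ge (1 - p) (1 - q).
rewrite subr_gt0 subr_ge0 => /(_ p1 (ltW (le_lt_trans qp p1))) h.
suff : (p - q) ^+ 2 / (4 * p) <= q * ln (q / p) + p - q by lra.
move: q0; rewrite le_eqVlt => /orP[/eqP<-|q0].
  rewrite mul0r !subr0 add0r ler_pdivrMr; nra.
have := @mul_ln_quadratic (q / p); rewrite divr_gt0// ler_pdivrMr// mul1r.
move=> /(_ qp); rewrite -(ler_pM2l p0).
have -> : p * ((1 - q / p) ^+ 2 / 4) = (p - q) ^+ 2 / (4 * p).
  by field; rewrite gt_eqF.
suff -> : p * (q / p * ln (q / p) + 1 - q / p) = q * ln (q / p) + p - q by [].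
by field; rewrite gt_eqF.
Qed.

Lemma mul_lnsq x : 0 <= x <= 1 -> x * ln x ^+ 2 <= 4.
Proof.
move=> /andP[]; rewrite le_eqVlt => /orP[/eqP<-|x0 x1]; first by rewrite mul0r.
have s0 : 0 < Num.sqrt x by rewrite sqrtr_gt0.
have Ex : x = Num.sqrt x ^+ 2 by rewrite sqr_sqrtr// ltW.
have s1 : Num.sqrt x <= 1 by rewrite -(@sqrtr1 R) ler_wsqrtr.
move: (Num.sqrt x) s0 Ex s1 => y y0 -> y1.
rewrite lnXn//.
have := subVr_le_ln y0; rewrite -(ler_pM2l y0) mulrBr divff ?gt_eqF// mulr1 => h.
have hl : ln y <= 0 by apply: ln_le0.
have h2 : y * ln y <= 0 by nra.
have -> : y ^+ 2 * (ln y *+ 2) ^+ 2 = 4 * (y * ln y) ^+ 2 by rewrite mulr2n; ring.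
nra.
Qed.

(** Both terms are O(p): the first because [x (ln x)^2] is bounded, the second
    because the logarithm itself is O(p). *)
Lemma log_ratio_second_moment p0 p q : p0 < 1 -> 0 < p <= p0 -> 0 <= q <= p ->
  q * ln (q / p) ^+ 2 + (1 - q) * ln ((1 - q) / (1 - p)) ^+ 2 <=
    (4 + (1 - p0)^-2) * p.
Proof.
move=> p01 /andP[pgt0 pp0] /andP[q0 qp]; rewrite [leRHS]mulrDl lerD//.
  have := @mul_lnsq (q / p); rewrite divr_ge0 ?(ltW pgt0)//= ler_pdivrMr// mul1r.
  move=> /(_ qp) h; have := ler_wpM2r (ltW pgt0) h.
  by rewrite mulrAC divfK ?gt_eqF.
have u0 : 0 < (1 - q) / (1 - p) by rewrite divr_gt0//; lra.
have l0 : 0 <= ln ((1 - q) / (1 - p)).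
  by apply: ln_ge0; rewrite ler_pdivlMr; lra.
have l1 : ln ((1 - q) / (1 - p)) <= p / (1 - p0).
  apply: le_trans (ln_le_subr1 u0) _.
  have -> : (1 - q) / (1 - p) - 1 = (p - q) / (1 - p) by field; lra.
  rewrite ler_pdivrMr; last lra.
  rewrite mulrAC ler_pdivlMr; last lra.
  nra.
have := ler_pM l0 l0 l1 l1; rewrite -!expr2 => h.
apply: (@le_trans _ _ (1 * (p / (1 - p0)) ^+ 2)).
  apply: ler_pM => //; [lra|exact: sqr_ge0|lra].
rewrite mul1r expr_div_n [leLHS]mulrC ler_wpM2l ?invr_ge0 ?sqr_ge0//; nra.
Qed.

End Entropy.

(** * Bernoulli random sets *)

Section ProductMeasure.
Context {R : realType} {E : finType}.
Implicit Types (q : E -> R) (p : R) (G W S : {set E}).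

Definition bern q G : R := \prod_e (if e \in G then q e else 1 - q e).

Lemma bern_ge0 q G : (forall e, 0 <= q e <= 1) -> 0 <= bern q G.
Proof.
move=> hq; apply: prodr_ge0 => e _; have /andP[? ?] := hq e.
by case: ifP => // _; rewrite subr_ge0.
Qed.

Lemma bern_expect_prod q (g : E -> bool -> R) :
  \sum_G bern q G * (\prod_e g e (e \in G)) =
  \prod_e (q e * g e true + (1 - q e) * g e false).
Proof.
rewrite bigA_distr; apply: eq_bigr => G _; rewrite -big_split /=.
by apply: eq_bigr => e _; case: ifP.
Qed.

Lemma bern_total q : \sum_G bern q G = 1.
Proof.
have := bern_expect_prod q (fun _ _ => 1).
rewrite (eq_bigr (bern q)); last by move=> G _; rewrite big1_eq mulr1.
by move=> ->; rewrite big1// => e _; rewrite !mulr1 addrC subrK.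
Qed.

Lemma bern_expect1 q e (g : bool -> R) :
  \sum_G bern q G * g (e \in G) = q e * g true + (1 - q e) * g false.
Proof.
have := bern_expect_prod q (fun x b => if x == e then g b else 1).
rewrite [X in _ = X](bigD1 e)//= eqxx [X in _ = _ * X]big1 ?mulr1; last first.
  by move=> i /negPf->; rewrite !mulr1 addrC subrK.
move=> <-; apply: eq_bigr => G _; congr (_ * _).
by rewrite (bigD1 e)//= eqxx big1 ?mulr1// => i /negPf->.
Qed.

Lemma bern_expect2 q e e' (g g' : bool -> R) : e != e' ->
  \sum_G bern q G * (g (e \in G) * g' (e' \in G)) =
  (q e * g true + (1 - q e) * g false) * (q e' * g' true + (1 - q e') * g' false).
Proof.
move=> ee'.
have := bern_expect_prod q (fun x b => if x == e then g b else
  if x == e' then g' b else 1).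
rewrite [X in _ = X](bigD1 e)//= eqxx [X in _ = _ * X](bigD1 e')/=; last first.
  by rewrite eq_sym.
rewrite eqxx eq_sym (negPf ee') [X in _ = _ * (_ * X)]big1 ?mulr1; last first.
  by move=> i /andP[/negPf-> /negPf->]; rewrite !mulr1 addrC subrK.
move=> <-; apply: eq_bigr => G _; congr (_ * _).
rewrite (bigD1 e)//= eqxx (bigD1 e')/=; last by rewrite eq_sym.
rewrite eqxx eq_sym (negPf ee') big1 ?mulr1//.
by move=> i /andP[/negPf-> /negPf->].
Qed.

Lemma bern_subset q S :
  \sum_G bern q G * (S \subset G)%:R = \prod_(e in S) q e.
Proof.
rewrite [RHS]big_mkcond /=.
have := bern_expect_prod q (fun x b => ((x \in S) ==> b)%:R).
rewrite [X in _ = X -> _](eq_bigr (fun e => if e \in S then q e else 1)).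
  move=> <-; apply: eq_bigr => G _; congr (_ * _).
  rewrite -natr_prod; congr (_%:R).
  apply/eqP; case: (boolP (S \subset G)) => [/fintype.subsetP h|/subsetPn[x xS xG]].
    by rewrite big1// => x _; case: (boolP (x \in S)) => //= /h->.
  by rewrite (bigD1 x)//= xS (negPf xG).
by move=> e _; case: (e \in S) => /=; rewrite ?mulr0 ?mulr1 ?addr0// addrC subrK.
Qed.

(** Centred functions of distinct points are orthogonal. *)
Lemma bern_second_moment q (Z : E -> bool -> R) :
  (forall e, q e * Z e true + (1 - q e) * Z e false = 0) ->
  \sum_G bern q G * (\sum_e Z e (e \in G)) ^+ 2 =
  \sum_e (q e * Z e true ^+ 2 + (1 - q e) * Z e false ^+ 2).
Proof.
move=> Z0.
under eq_bigr => G _ do rewrite expr2 big_distrlr /= mulr_sumr.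
rewrite exchange_big /=; apply: eq_bigr => e _.
under eq_bigr => G _ do rewrite mulr_sumr.
rewrite exchange_big (bigD1 e)//= [X in _ + X]big1 ?addr0; last first.
  by move=> e' e'e; rewrite (bern_expect2 _ (Z e) (Z e')) ?Z0 ?mul0r// eq_sym.
rewrite -(bern_expect1 q e (fun b => Z e b ^+ 2)).
by apply: eq_bigr => G _; rewrite expr2.
Qed.

(** Lets the parameters off [W] depend on the trace on [W]. *)
Lemma bern_marginal q q' W S : S \subset W -> {in W, q =1 q'} ->
  \sum_(G : {set E} | G :&: W == S) bern q G =
  \sum_(G : {set E} | G :&: W == S) bern q' G.
Proof.
move=> SW qq'.
have ind q0 : \sum_(G : {set E} | G :&: W == S) bern q0 G =
    \prod_e (if e \in W then (if e \in S then q0 e else 1 - q0 e) else 1).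
  pose g e b : R := ((e \in W) ==> (b == (e \in S)))%:R.
  rewrite [RHS](eq_bigr (fun e => q0 e * g e true + (1 - q0 e) * g e false)).
    rewrite -bern_expect_prod big_mkcond /=; apply: eq_bigr => G _.
    rewrite -natr_prod; case: eqP => [<-|/eqP/eqP GWS].
      rewrite big1 ?mulr1// => e _; rewrite inE.
      by case: (e \in W) => //=; rewrite andbT eqxx.
    have [e he] : exists e, (e \in W) && ((e \in G) != (e \in S)).
      apply/existsP; rewrite -[[exists _, _]]negbK negb_exists; apply/negP.
      move=> /forallP h; apply: GWS; apply/setP => e; rewrite inE.
      have := h e; case: (boolP (e \in W)) => [_|eW] /=.
        by rewrite negbK andbT => /eqP.
      rewrite andbF => _; apply/esym/negP => /(fintype.subsetP SW).
      exact/negP.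
    rewrite (bigD1 e)//=; move/andP: he => [-> /negPf->].
    by rewrite mul0n mulr0.
  move=> e _; rewrite /g; case: (e \in W) => /=.
    by case: (e \in S); rewrite ?mulr0 ?mulr1 ?addr0 ?add0r.
  by rewrite !mulr1 addrC subrK.
rewrite !ind; apply: eq_bigr => e _.
by case: (boolP (e \in W)) => // eW; rewrite qq'.
Qed.

(** Deletion of [e] is injective on the sets that contain [e], and multiplies
    the weight by [(1 - p) / p]. *)
Lemma bern_delete_closed p e (B : pred {set E}) : 0 < p < 1 ->
  (forall G, B G -> B (G :\ e)) ->
  \sum_(G | B G && (e \in G)) bern (fun=> p) G <=
  p * \sum_(G | B G) bern (fun=> p) G.
Proof.
move=> /andP[p0 p1] hB.
have wE G : e \in G ->
    bern (fun=> p) G * (1 - p) = p * bern (fun=> p) (G :\ e).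
  move=> eG; rewrite /bern (bigD1 e)//= eG [in RHS](bigD1 e)//= !inE eqxx /=.
  rewrite -mulrA; congr (_ * _); rewrite mulrC; congr (_ * _).
  by apply: eq_bigr => x xe; rewrite !inE xe.
rewrite [X in _ <= _ * X](bigID (fun G => e \in G))/=.
set a := \sum_(G | B G && (e \in G)) _.
set b := \sum_(G | B G && (e \notin G)) _.
suff h : a * (1 - p) <= p * b by nra.
rewrite /a mulr_suml (eq_bigr (fun G => p * bern (fun=> p) (G :\ e))); last first.
  by move=> G /andP[_ eG]; rewrite wE.
rewrite -mulr_sumr ler_wpM2l ?(ltW p0)//.
rewrite (reindex_onto (fun G => e |: G) (fun G => G :\ e))/=; last first.
  by move=> G /andP[_ eG]; rewrite finset.setD1K.
rewrite /b big_mkcond [leRHS]big_mkcond /=; apply: ler_sum => G _.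
have w0 : 0 <= bern (fun=> p) G by apply: bern_ge0 => _; rewrite !ltW.
case: ifP => [/andP[/andP[BG eG] /eqP GE]|_]; last by case: ifP.
have eG' : e \notin G by rewrite -GE !inE eqxx.
have := hB _ BG; rewrite GE eG' => -> /=.
by rewrite lexx.
Qed.

(** The only form of Harris's inequality that the proof needs; it follows from
    deleting the points of [S] one by one. *)
Lemma bern_decreasing_subset p (B : pred {set E}) S : 0 < p < 1 ->
  (forall G e, B G -> B (G :\ e)) ->
  \sum_(G | B G && (S \subset G)) bern (fun=> p) G <=
  p ^+ #|S| * \sum_(G | B G) bern (fun=> p) G.
Proof.
move=> p01 hB; move: {2}#|S| (erefl #|S|) => k.
elim: k S => [|k IH] S kS.
  move/eqP: kS; rewrite cards_eq0 => /eqP->; rewrite cards0 expr0 mul1r.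
  by rewrite (eq_bigl B)// => G; rewrite finset.sub0set andbT.
have /card_gt0P[e eS] : (0 < #|S|)%N by rewrite kS.
have kS' : #|S :\ e| = k by move: kS; rewrite (cardsD1 e) eS => -[].
have := IH _ kS'; rewrite kS' kS => h; rewrite exprS -mulrA.
apply: le_trans (ler_wpM2l _ h); last by case/andP: p01 => /ltW.
have hB' G : B G && (S :\ e \subset G) -> B (G :\ e) && (S :\ e \subset G :\ e).
  move=> /andP[/hB-> /fintype.subsetP SG] /=; apply/fintype.subsetP => x xS.
  by have := SG _ xS; move: xS; rewrite !inE => /andP[-> _].
apply: le_trans (bern_delete_closed p01 hB'); rewrite le_eqVlt; apply/orP; left.
apply/eqP/eq_bigl => G; rewrite -andbA; congr (_ && _).
apply/idP/andP => [h1|[h1 h2]].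
  by split; [exact: fintype.subset_trans (subsetDl _ _) h1|exact: (fintype.subsetP h1)].
by rewrite -(finset.setD1K eS) finset.subUset finset.sub1set h2.
Qed.

End ProductMeasure.

(** * Conditional means on a finite space *)

Section ConditionalMean.
Context {R : realType} {Omega : finType} {T : eqType}.
Variable m : Omega -> R.
Hypothesis m_ge0 : forall x, 0 <= m x.
Implicit Types (pi : Omega -> T) (g h : Omega -> R).

Definition fibre_mass pi x : R := \sum_(y | pi y == pi x) m y.

(** Its value is 0 on a fibre of mass 0. *)
Definition cond_mean pi g x : R :=
  (\sum_(y | pi y == pi x) m y * g y) / fibre_mass pi x.

Lemma fibre_mass_gt0 pi x : 0 < m x -> 0 < fibre_mass pi x.
Proof.
move=> h; rewrite /fibre_mass (bigD1 x)//= ltr_pwDl// sumr_ge0//.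
Qed.

Lemma cond_mean_fibre pi g x y : pi x = pi y ->
  cond_mean pi g x = cond_mean pi g y.
Proof. by move=> h; rewrite /cond_mean /fibre_mass h. Qed.

Lemma cond_mean_le pi g x (c : R) : 0 <= c ->
  \sum_(y | pi y == pi x) m y * g y <= c * fibre_mass pi x ->
  cond_mean pi g x <= c.
Proof.
move=> c0; rewrite /cond_mean.
have : 0 <= fibre_mass pi x by apply: sumr_ge0.
rewrite le_eqVlt => /orP[/eqP<-|f0]; first by rewrite invr0 !mulr0.
by rewrite ler_pdivrMr.
Qed.

Lemma cond_mean_ge0 pi g x : (forall y, 0 <= g y) -> 0 <= cond_mean pi g x.
Proof.
move=> g0; apply: divr_ge0; apply: sumr_ge0 => y _ //.
by rewrite mulr_ge0.
Qed.

Lemma cond_mean_tower pi g h : (forall x y, pi x = pi y -> h x = h y) ->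
  \sum_x m x * (h x * cond_mean pi g x) = \sum_x m x * (h x * g x).
Proof.
move=> hpi.
transitivity (\sum_x \sum_y (if pi y == pi x then
    m x * h x * (m y * g y) / fibre_mass pi x else 0)).
  apply: eq_bigr => x _; rewrite -big_mkcond /= /cond_mean !mulrA mulr_sumr.
  by rewrite mulr_suml.
rewrite exchange_big /=; apply: eq_bigr => y _.
transitivity (\sum_(x | pi x == pi y) m x * (h y * (m y * g y) / fibre_mass pi y)).
  rewrite [RHS]big_mkcond; apply: eq_bigr => x _; rewrite eq_sym.
  case: eqP => // e; rewrite (hpi _ _ e) /fibre_mass e.
  by rewrite !mulrA.
rewrite -mulr_suml -/(fibre_mass pi y).
have := m_ge0 y; rewrite le_eqVlt => /orP[/eqP<-|my].
  by rewrite !mul0r mulr0 mul0r mulr0.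
have := fibre_mass_gt0 pi my => f0.
by field; rewrite gt_eqF.
Qed.

(** The coarser conditional mean is the orthogonal projection of the finer one. *)
Lemma cond_mean_pythagoras pi pi' g :
  (forall x y, pi' x = pi' y -> pi x = pi y) ->
  \sum_x m x * (cond_mean pi' g x - cond_mean pi g x) ^+ 2 =
  \sum_x m x * cond_mean pi' g x ^+ 2 - \sum_x m x * cond_mean pi g x ^+ 2.
Proof.
move=> hpi.
have tow : \sum_x m x * (cond_mean pi g x * cond_mean pi' g x) =
    \sum_x m x * cond_mean pi g x ^+ 2.
  rewrite cond_mean_tower; last by move=> x y /hpi; exact: cond_mean_fibre.
  rewrite -(@cond_mean_tower pi g (cond_mean pi g)); last first.
    by move=> x y; exact: cond_mean_fibre.
  by apply: eq_bigr => x _; rewrite expr2.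
have -> : \sum_x m x * (cond_mean pi' g x - cond_mean pi g x) ^+ 2 =
   \sum_x m x * cond_mean pi' g x ^+ 2 + \sum_x m x * cond_mean pi g x ^+ 2
   - 2 * \sum_x m x * (cond_mean pi g x * cond_mean pi' g x).
  rewrite mulr_sumr -big_split -sumrB /=; apply: eq_bigr => x _; ring.
rewrite tow; ring.
Qed.

End ConditionalMean.

(** * Conditioning on a decreasing event *)

Section Conditioning.
Context {R : realType} {E : finType}.
Variables (p : R) (A : pred {set E}).
Hypotheses (p01 : 0 < p < 1) (A_delete : forall G e, A G -> A (G :\ e)).
Implicit Types (G W S : {set E}) (e : E).

(** The conditioned law, not normalised: its total is the probability of [A]. *)
Definition cond_mass G : R := if A G then bern (fun=> p) G else 0.

Lemma bern_p_ge0 G : 0 <= bern (fun=> p) G.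
Proof. by apply: bern_ge0 => _; case/andP: p01 => /ltW-> /ltW->. Qed.

Lemma cond_mass_ge0 G : 0 <= cond_mass G.
Proof. by rewrite /cond_mass; case: ifP => // _; exact: bern_p_ge0. Qed.

Definition cond_total : R := \sum_G cond_mass G.

Lemma cond_totalE : cond_total = \sum_(G | A G) bern (fun=> p) G.
Proof. by rewrite [RHS]big_mkcond. Qed.

Lemma cond_mass_subset S :
  \sum_G cond_mass G * (S \subset G)%:R <= p ^+ #|S| * cond_total.
Proof.
rewrite cond_totalE.
apply: le_trans (bern_decreasing_subset S p01 A_delete).
rewrite [leRHS]big_mkcond /=; apply: ler_sum => G _; rewrite /cond_mass.
by case: (A G) => /=; case: (S \subset G); rewrite ?mulr1 ?mulr0 ?mul0r.
Qed.

(** The probability of [e] given [A] and the trace on [W]. *)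
Definition post W e G : R :=
  cond_mean cond_mass (fun G' => G' :&: W) (fun G' => (e \in G')%:R) G.

Lemma post_ge0 W e G : 0 <= post W e G.
Proof. by apply: cond_mean_ge0; [exact: cond_mass_ge0|move=> y; exact: ler0n]. Qed.

(** Fixing the trace on [W] leaves the event stable by deletion of [e]. *)
Lemma post_le W e G : e \notin W -> post W e G <= p.
Proof.
move=> eW; apply: cond_mean_le; first exact: cond_mass_ge0.
  by case/andP: p01 => /ltW.
pose B G' := A G' && (G' :&: W == G :&: W).
have hB G' : B G' -> B (G' :\ e).
  move=> /andP[hA /eqP GW]; rewrite /B A_delete//= -GW; apply/eqP/setP => x; rewrite !inE.
  by case: eqP => [->|//]; rewrite (negPf eW) !andbF.
have := bern_delete_closed p01 hB.
rewrite /fibre_mass ![\sum_(_ | _ == _) _]big_mkcond /=.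
rewrite ![\sum_(_ | B _) _]big_mkcond ![\sum_(_ | B _ && _) _]big_mkcond /=.
rewrite (eq_bigr (fun G' => if G' :&: W == G :&: W then
   cond_mass G' * (e \in G')%:R else 0)); last first.
  move=> G' _; rewrite /B /cond_mass.
  by case: (A G'); case: eqP => //=; case: (e \in G'); rewrite /= ?mulr1 ?mulr0 ?mul0r.
rewrite [X in _ <= p * X -> _](eq_bigr (fun G' => if G' :&: W == G :&: W then
   cond_mass G' else 0))//.
by move=> G' _; rewrite /B /cond_mass; case: (A G'); case: eqP.
Qed.

Lemma post_fibre W e G G' : G :&: W = G' :&: W -> post W e G = post W e G'.
Proof. by move=> h; apply: cond_mean_fibre. Qed.

Lemma post_tower W e (h : {set E} -> R) :
  (forall G G', G :&: W = G' :&: W -> h G = h G') ->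
  \sum_G cond_mass G * (h G * post W e G) =
  \sum_G cond_mass G * (h G * (e \in G)%:R).
Proof. move=> hW; exact: (cond_mean_tower cond_mass_ge0). Qed.

Lemma post_gt0 W e G : 0 < cond_mass G -> e \in G -> 0 < post W e G.
Proof.
move=> mG eG; apply: divr_gt0; last exact: fibre_mass_gt0 cond_mass_ge0 _ _ mG.
rewrite (bigD1 G)//= eG mulr1 ltr_pwDl// sumr_ge0// => y _.
by rewrite mulr_ge0// cond_mass_ge0.
Qed.

(** The likelihood ratio against [p] of the measure that samples [W] from [p]
    and then every other point independently with its posterior. *)
Definition post_ratio W G : R := \prod_(e in ~: W)
  (if e \in G then post W e G / p else (1 - post W e G) / (1 - p)).

Lemma post_ratio_ge0 W G : 0 <= post_ratio W G.
Proof.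
have /andP[p0 p1] := p01.
apply: prodr_ge0 => e; rewrite inE => eW.
have := post_ge0 W e G; have := post_le G eW => h1 h0.
by case: ifP => _; apply: divr_ge0; lra.
Qed.

(** The posteriors depend on the trace on [W] only, so the measure in question
    has total mass 1 on each fibre of the trace. *)
Lemma post_ratio_total W : \sum_G bern (fun=> p) G * post_ratio W G = 1.
Proof.
have /andP[p0 p1] := p01.
pose Q y e := if e \in W then p else post W e y.
rewrite -(bern_total (fun _ : E => p)).
transitivity (\sum_G bern (Q G) G).
  apply: eq_bigr => G _; rewrite /post_ratio [X in _ * X]big_mkcond -big_split /=.
  apply: eq_bigr => e _; rewrite /Q inE; case: (e \in W); first by rewrite mulr1.
  by case: (e \in G) => /=; rewrite mulrC divfK//; lra.
rewrite (partition_big (fun G => G :&: W) xpredT)//=.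
rewrite [RHS](partition_big (fun G => G :&: W) xpredT)//=.
apply: eq_bigr => S _.
have [SW|SW] := boolP (S \subset W); last first.
  have no G : G :&: W == S = false.
    by apply/negP => /eqP GS; move: SW; rewrite -GS finset.subsetIr.
  by rewrite !big_pred0.
rewrite -(@bern_marginal _ _ (Q S) (fun=> p) W S SW); last first.
  by move=> e eW; rewrite /Q eW.
apply: eq_bigr => G /eqP GS; congr bern.
apply/funext => e; rewrite /Q; case: ifP => // _; apply: post_fibre.
by rewrite -GS -finset.setIA finset.setIid.
Qed.

(** Gibbs' inequality: comparing the conditioned law with the measure of ratio
    [post_ratio W] gives a mean log-ratio of at most minus the logarithm of the
    probability of [A]; by the tower property this mean is the entropy sum. *)
Lemma post_entropy W : 0 < cond_total ->
  \sum_G cond_mass G * (\sum_(e in ~: W) rel_entropy p (post W e G)) <=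
  cond_total * - ln cond_total.
Proof.
move=> Z0; have /andP[p0 p1] := p01.
have hE : \sum_G cond_mass G * (\sum_(e in ~: W) rel_entropy p (post W e G)) =
   \sum_G cond_mass G * (\sum_(e in ~: W) (if e \in G then ln (post W e G / p)
     else ln ((1 - post W e G) / (1 - p)))).
  under eq_bigr => G _ do rewrite mulr_sumr.
  under [RHS]eq_bigr => G _ do rewrite mulr_sumr.
  rewrite exchange_big [RHS]exchange_big /=; apply: eq_bigr => e _.
  pose h1 G := ln (post W e G / p) - ln ((1 - post W e G) / (1 - p)).
  pose h0 G := ln ((1 - post W e G) / (1 - p)).
  transitivity (\sum_G cond_mass G * (h1 G * post W e G) + \sum_G cond_mass G * h0 G).
    rewrite -big_split /=; apply: eq_bigr => G _.
    by rewrite /rel_entropy /h1 /h0; ring.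
  rewrite post_tower; last first.
    by move=> G G' GG'; rewrite /h1 (post_fibre e GG').
  rewrite -big_split /=; apply: eq_bigr => G _.
  by rewrite /h1 /h0; case: (e \in G) => /=; ring.
rewrite hE.
have key G : cond_mass G * (\sum_(e in ~: W) (if e \in G then ln (post W e G / p)
     else ln ((1 - post W e G) / (1 - p)))) <=
   cond_mass G * (cond_total * post_ratio W G - 1 - ln cond_total).
  have := cond_mass_ge0 G; rewrite le_eqVlt => /orP[/eqP<-|mG].
    by rewrite !mul0r.
  rewrite ler_pM2l//.
  have pos e : e \in ~: W ->
      0 < (if e \in G then post W e G / p else (1 - post W e G) / (1 - p)).
    rewrite inE => eW; case: ifP => eG; first by rewrite divr_gt0// post_gt0.
    by have := post_le G eW => h; rewrite divr_gt0//; lra.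
  have -> : \sum_(e in ~: W) (if e \in G then ln (post W e G / p)
     else ln ((1 - post W e G) / (1 - p))) = ln (post_ratio W G).
    rewrite /post_ratio; apply: (@proj2 (0 < \prod_(e in ~: W)
      (if e \in G then post W e G / p else (1 - post W e G) / (1 - p)))).
    elim/big_ind2 : _ => [|x1 x2 y1 y2 [h1 ->] [h2 ->]|e eW].
    - by rewrite ln1.
    - by rewrite mulr_gt0// lnM.
    - by split; [exact: pos|case: ifP].
  have r0 : 0 < post_ratio W G by apply: prodr_gt0.
  have := @ln_le_subr1 _ (cond_total * post_ratio W G).
  rewrite mulr_gt0// => /(_ isT); rewrite lnM ?posrE//; lra.
apply: le_trans (ler_sum _ (fun G _ => key G)) _.
have -> : \sum_G cond_mass G * (cond_total * post_ratio W G - 1 - ln cond_total) =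
   cond_total * (\sum_G cond_mass G * post_ratio W G) -
   (\sum_G cond_mass G) * (1 + ln cond_total).
  rewrite mulr_sumr mulr_suml -sumrB; apply: eq_bigr => G _.
  by ring.
have : \sum_G cond_mass G * post_ratio W G <= 1.
  rewrite -(post_ratio_total W); apply: ler_sum => G _.
  rewrite ler_wpM2r ?post_ratio_ge0// /cond_mass; case: ifP => // _.
  exact: bern_p_ge0.
rewrite -/cond_total => h; nra.
Qed.

End Conditioning.

(** * Random colourings *)

Section Colouring.
Context {R : realType} {E : finType} {K : nat}.
Local Notation colouring := {ffun E -> 'I_K}.
Implicit Types (tau : colouring) (g : colouring -> R) (e : E) (c : 'I_K).

Definition recolour tau e c : colouring := [ffun x => if x == e then c else tau x].

Lemma recolourK tau e c : tau e = c -> forall c', recolour (recolour tau e c') e c = tau.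
Proof.
by move=> tc c'; apply/ffunP => x; rewrite !ffunE; case: eqP => // ->.
Qed.

Lemma sum_colour_swap g e c c' :
  (forall tau, tau e = c' -> g (recolour tau e c) = g tau) ->
  \sum_(tau : colouring | tau e == c) g tau = \sum_(tau : colouring | tau e == c') g tau.
Proof.
move=> gc; rewrite (reindex_onto (fun tau => recolour tau e c)
   (fun tau => recolour tau e c')) /=; last first.
  by move=> tau /eqP tc; rewrite recolourK.
apply: eq_big => [tau|tau /andP[_ /eqP h]].
  rewrite ffunE !eqxx /=; apply/eqP/eqP => [<-|h]; last by rewrite recolourK.
  by rewrite ffunE eqxx.
by rewrite gc// -h ffunE eqxx.
Qed.

Lemma sum_colour_cylinder (P : pred colouring) (S : {set E}) : (0 < K)%N ->
  (forall tau tau', P tau -> P tau' -> {in S, tau =1 tau'}) ->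
  \sum_(tau : colouring) (P tau)%:R <= K%:R ^+ #|E| / K%:R ^+ #|S| :> R.
Proof.
move=> K0 hP; have KR0 : 0 < K%:R :> R by rewrite ltr0n.
case: (pickP P) => [tau0 P0|nP]; last first.
  rewrite big1 ?divr_ge0 ?exprn_ge0 ?ler0n// => tau _.
  by rewrite nP.
pose F e c : R := ((e \in S) ==> (c == tau0 e))%:R.
apply: (@le_trans _ _ (\sum_(tau : colouring) \prod_e F e (tau e))).
  apply: ler_sum => tau _; case: (boolP (P tau)) => Pt; last first.
    by apply: prodr_ge0 => e _; rewrite ler0n.
  rewrite big1// => e _; rewrite /F; case: (boolP (e \in S)) => //= eS.
  by rewrite (hP _ _ Pt P0)// eqxx.
rewrite -bigA_distr_bigA /=.
have -> : \prod_i \sum_j F i j = \prod_(i in ~: S) (K%:R : R).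
  rewrite [RHS]big_mkcond; apply: eq_bigr => e _; rewrite inE /F.
  case: (e \in S) => /=.
    by rewrite (bigD1 (tau0 e))//= eqxx big1 ?addr0// => c /negPf->.
  by rewrite sumr_const card_ord.
rewrite prodr_const -(cardsC S) exprD mulrAC divff ?mul1r//.
by rewrite expf_neq0// gt_eqF.
Qed.

(** Every colour from [j] on can be exchanged for any other without affecting
    [g], so a prescribed colour is one of [K - j] equally heavy cases. *)
Lemma sum_colour_prescribe g (j : nat) (s : seq (E * 'I_K)) :
  (forall tau e c, (j <= tau e)%N -> (j <= c)%N -> g (recolour tau e c) = g tau) ->
  uniq (unzip1 s) -> all (fun x : E * 'I_K => j <= x.2)%N s ->
  \sum_(tau : colouring | all (fun x : E * 'I_K => j <= tau x.1)%N s) g tau =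
  (K - j)%:R ^+ size s * \sum_(tau : colouring | all (fun x : E * 'I_K => tau x.1 == x.2) s) g tau.
Proof.
elim: s g => [|[e c] s IH] g hg /=; first by rewrite mul1r.
move=> /andP[es us] /andP[jc js].
pose g1 tau := (j <= tau e)%N%:R * g tau.
have hg1 tau e' c' : (j <= tau e')%N -> (j <= c')%N -> g1 (recolour tau e' c') = g1 tau.
  move=> h1 h2; rewrite /g1 hg// ffunE; case: eqP => // ->.
  by rewrite h1 h2.
have := IH g1 hg1 us js; rewrite /g1 => h.
transitivity (\sum_(tau : colouring | all (fun x : E * 'I_K => j <= tau x.1)%N s) g1 tau).
  rewrite big_mkcond [RHS]big_mkcond; apply: eq_bigr => tau _; rewrite /g1.
  by case: (j <= tau e)%N; rewrite ?mul1r ?mul0r//=; case: ifP.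
rewrite h exprS [RHS]mulrAC mulrC; congr (_ * _).
pose g2 tau := (all (fun x : E * 'I_K => tau x.1 == x.2) s)%:R * g tau.
have hg2 tau (c' : 'I_K) : (j <= tau e)%N -> (j <= c')%N -> g2 (recolour tau e c') = g2 tau.
  move=> h1 h2; rewrite /g2 hg//; congr (_%:R * _); congr nat_of_bool.
  apply: eq_in_all => -[x d] xs /=; rewrite ffunE; case: (eqVneq x e) => // xe.
  by move: es; rewrite -xe => /negP[]; apply/mapP; exists (x, d).
transitivity (\sum_(tau : colouring | (j <= tau e)%N) g2 tau).
  rewrite big_mkcond [RHS]big_mkcond; apply: eq_bigr => tau _; rewrite /g2.
  by case: (all _ _); case: (_ <= _)%N; rewrite ?mul1r ?mul0r.
transitivity (\sum_(d : 'I_K | (j <= d)%N) \sum_(tau : colouring | tau e == d) g2 tau).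
  rewrite (partition_big (fun tau => tau e) (fun d : 'I_K => (j <= d)%N))//=.
  apply: eq_bigr => d jd; apply: eq_bigl => tau.
  by case: eqP => [->|]; rewrite ?jd ?andbF.
have sw (d : 'I_K) : (j <= d)%N ->
    \sum_(tau : colouring | tau e == d) g2 tau = \sum_(tau : colouring | tau e == c) g2 tau.
  by move=> jd; apply: sum_colour_swap => tau te; rewrite hg2// te.
rewrite (eq_bigr _ sw) sumr_const -[LHS]mulr_natl; congr (_%:R * _).
  have -> : #|[pred d : 'I_K | (j <= d)%N]| = #|~: [set d : 'I_K | (d < j)%N]|.
    by apply: eq_card => d; rewrite !inE leqNgt.
  have jK : (j <= K)%N by apply: leq_trans jc _; apply: ltnW.
  rewrite cardsCs finset.setCK card_ord; congr (_ - _)%N.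
  rewrite -sum1_card (eq_bigl (fun d : 'I_K => (d < j)%N)); last by move=> d; rewrite inE.
  by rewrite (big_ord_narrow_cond jK (P := xpredT)) /= sum1_card card_ord.
rewrite big_mkcond [RHS]big_mkcond; apply: eq_bigr => tau _; rewrite /g2.
by case: (all _ _); case: (tau e == c); rewrite ?mul1r ?mul0r.
Qed.

End Colouring.

(** In the application [y] are the indicators and [x] the predictions: when the
    [k]-th factor is replaced, the earlier ones are still the exposed
    indicators and the later ones are already predictions. *)
Lemma prod_telescope (R : comPzRingType) (r : nat) (x y : 'I_r -> R) :
  \prod_i x i - \prod_i y i =
  \sum_(k < r) (\prod_(i < r | (i < k)%N) y i) * (x k - y k) *
               (\prod_(i < r | (k < i)%N) x i).
Proof.
elim: r x y => [|r IH] x y; first by rewrite !big_ord0 subrr.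
rewrite !big_ord_recr /=.
have -> : \prod_(i < r.+1 | (i < r)%N) y i = \prod_(i < r) y (widen_ord (leqnSn r) i).
  rewrite big_mkcond big_ord_recr /= ltnn mulr1.
  by apply: eq_bigr => i _; rewrite /= ltn_ord.
have -> : \prod_(i < r.+1 | (r < i)%N) x i = 1.
  by rewrite big1// => i; rewrite ltnNge -ltnS ltn_ord.
have := IH (fun i => x (widen_ord (leqnSn r) i)) (fun i => y (widen_ord (leqnSn r) i)).
set X := \prod_(i < r) x _; set Y := \prod_(i < r) y _ => h.
have -> : X * x ord_max - Y * y ord_max =
  (X - Y) * x ord_max + Y * (x ord_max - y ord_max) * 1 by ring.
rewrite h mulr_suml; congr (_ + _); apply: eq_bigr => k _.
have -> : \prod_(i < r.+1 | (i < widen_ord (leqnSn r) k)%N) y i =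
   \prod_(i < r | (i < k)%N) y (widen_ord (leqnSn r) i).
  rewrite big_mkcond big_ord_recr /= ltnNge (ltnW (ltn_ord k)) mulr1.
  by rewrite -big_mkcond.
have -> : \prod_(i < r.+1 | (widen_ord (leqnSn r) k < i)%N) x i =
   (\prod_(i < r | (k < i)%N) x (widen_ord (leqnSn r) i)) * x ord_max.
  rewrite big_mkcond big_ord_recr /= ltn_ord.
  by rewrite -big_mkcond.
by rewrite !mulrA.
Qed.

Lemma exists_small_increment (R : realFieldType) (u : nat -> R) (b : R) (J : nat) :
  (0 < J)%N -> 0 <= u 0%N -> u J <= b ->
  exists2 l, (l < J)%N & u l.+1 - u l <= b / J%:R.
Proof.
move=> J0 u0 uJ; have JR : 0 < J%:R :> R by rewrite ltr0n.
apply: contrapT => h.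
have : \sum_(0 <= l < J) (u l.+1 - u l) > \sum_(0 <= l < J) (b / J%:R).
  apply: ltr_sum_nat => // i /andP[_ iJ].
  by rewrite ltNge; apply/negP => hi; apply: h; exists i.
rewrite telescope_sumr// sumr_const_nat subn0 -[ltLHS]mulr_natr divfK ?gt_eqF//.
lra.
Qed.

(** * Exposure of colours and the energy increment *)

Section Exposure.
Context {R : realType} {E I : finType} {r K : nat}.
Variables (phi : I -> 'I_r -> E) (p : R) (A : pred {set E}).
Hypotheses (p01 : 0 < p < 1) (A_delete : forall G e, A G -> A (G :\ e)).
Hypotheses (phi_inj : forall f, injective (phi f)) (K_gt0 : (0 < K)%N).
Local Notation colouring := {ffun E -> 'I_K}.
Local Notation m := (cond_mass p A).
Local Notation Z := (cond_total p A).
Implicit Types (G W S : {set E}) (e : E) (f : I) (tau : colouring) (j c : nat).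
Implicit Types k : 'I_r.

Definition below j tau : {set E} := [set e | (tau e < j)%N].

Lemma below_recolour j tau e (c : 'I_K) : (j <= tau e)%N -> (j <= c)%N ->
  below j (recolour tau e c) = below j tau.
Proof.
move=> h1 h2; apply/setP => x; rewrite !inE ffunE; case: eqP => // ->.
by rewrite ltnNge h2 ltnNge h1.
Qed.

Lemma trace_mono W W' G G' : W \subset W' ->
  G :&: W' = G' :&: W' -> G :&: W = G' :&: W.
Proof.
move=> /finset.setIidPr <- h.
by rewrite !finset.setIA h.
Qed.

Lemma below_mono j c tau : (j <= c)%N -> below j tau \subset below c tau.
Proof.
by move=> jc; apply/fintype.subsetP => e; rewrite !inE => h; exact: leq_trans h jc.
Qed.

Lemma cond_mass_nneg G : 0 <= m G. Proof. exact: cond_mass_ge0. Qed.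

(** An energy in the sense of regularity lemmas.  Keeping [c] apart from [j]
    allows the same points to be predicted at two levels. *)
Definition energy j c : R := \sum_(tau : colouring) \sum_(e | tau e == c :> nat)
  \sum_G m G * post p A (below j tau) e G ^+ 2.

Lemma energyE j c : energy j c = \sum_e \sum_(tau : colouring | tau e == c :> nat)
  \sum_G m G * post p A (below j tau) e G ^+ 2.
Proof. by rewrite /energy (exchange_big_dep xpredT). Qed.

(** The prediction of [e] ignores which of the unexposed colours [e] has. *)
Lemma energy_colour j c c' : (j <= c < K)%N -> (j <= c' < K)%N ->
  energy j c = energy j c'.
Proof.
move=> /andP[jc cK] /andP[jc' c'K]; rewrite !energyE; apply: eq_bigr => e _.
apply: (@sum_colour_swap _ _ _ (fun tau => \sum_G m G * post p A (below j tau) e G ^+ 2)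
  e (Ordinal cK) (Ordinal c'K)) => tau te.
by rewrite below_recolour// te.
Qed.

(** Pythagoras, once [energy_colour] has moved the points of colour [j] to
    colour [c]. *)
Lemma energy_gap j c : (j <= c < K)%N ->
  \sum_(tau : colouring) \sum_(e | tau e == c :> nat)
    \sum_G m G * (post p A (below c tau) e G - post p A (below j tau) e G) ^+ 2 =
  energy c c - energy j j.
Proof.
move=> /andP[jc cK]; rewrite (@energy_colour j j c) ?jc ?leqnn ?(leq_ltn_trans jc)//.
rewrite /energy -sumrB; apply: eq_bigr => tau _; rewrite -sumrB; apply: eq_bigr => e _.
apply: cond_mean_pythagoras => [G|G G']; first exact: cond_mass_nneg.
exact/trace_mono/below_mono.
Qed.

Lemma energy_mono j c : (j <= c < K)%N -> energy j j <= energy c c.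
Proof.
move=> /energy_gap h; rewrite -subr_ge0 -h; do 3 (apply: sumr_ge0 => ? _).
by rewrite mulr_ge0 ?sqr_ge0// cond_mass_nneg.
Qed.

Lemma sum_colour_class_le e c : \sum_(tau : colouring) (tau e == c :> nat)%:R <=
  K%:R ^+ #|E| / K%:R :> R.
Proof.
rewrite -[X in _ / X]expr1 -(cards1 e).
apply: sum_colour_cylinder => // tau tau' /eqP h /eqP h' x.
by rewrite inE => /eqP->; apply: val_inj => /=; rewrite h h'.
Qed.

Lemma energy_le j : energy j j <= Z * p ^+ 2 * #|E|%:R * (K%:R ^+ #|E| / K%:R).
Proof.
have pge0 : 0 <= p by case/andP: p01 => /ltW.
have Z0 : 0 <= Z by apply: sumr_ge0 => G _; exact: cond_mass_nneg.
rewrite energyE; apply: (@le_trans _ _ (\sum_(e : E) Z * p ^+ 2 * (K%:R ^+ #|E| / K%:R))).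
  apply: ler_sum => e _.
  apply: (@le_trans _ _ (Z * p ^+ 2 * \sum_(tau : colouring) (tau e == j :> nat)%:R)).
    rewrite mulr_sumr big_mkcond /=; apply: ler_sum => tau _.
    case: eqP => [te|_]; last by rewrite mulr0.
    rewrite mulr1 mulr_suml; apply: ler_sum => G _.
    rewrite ler_wpM2l ?cond_mass_nneg// ler_sqr ?nnegrE ?post_ge0//.
    by rewrite post_le// inE te ltnn.
  rewrite ler_wpM2l ?mulr_ge0 ?exprn_ge0//.
  exact: sum_colour_class_le.
by rewrite sumr_const -[leLHS]mulr_natr le_eqVlt; apply/orP; left; apply/eqP; ring.
Qed.

Lemma energy_ge0 j : 0 <= energy j j.
Proof.
do 3 (apply: sumr_ge0 => ? _).
by rewrite mulr_ge0 ?sqr_ge0// cond_mass_nneg.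
Qed.

(** The levels 0, r, 2r, ..., (J-1)r have increments that sum to at most the
    trivial bound on the energy. *)
Lemma exists_stable_level (J : nat) : (0 < J)%N -> (r * J < K)%N ->
  exists2 j, (j + r <= r * J)%N & energy (j + r) (j + r) - energy j j <=
    Z * p ^+ 2 * #|E|%:R * (K%:R ^+ #|E| / K%:R) / J%:R.
Proof.
move=> J0 JK; have [l lJ hl] := @exists_small_increment _
  (fun l => energy (r * l) (r * l)) _ J J0 (energy_ge0 _) (energy_le (r * J)).
exists (r * l)%N; first by rewrite -mulnSr leq_mul2l lJ orbT.
by rewrite -mulnSr.
Qed.

Definition rainbow j tau f := [forall i : 'I_r, tau (phi f i) == (j + i)%N :> nat].

Lemma rainbowP j tau f i : rainbow j tau f -> tau (phi f i) = (j + i)%N :> nat.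
Proof. by move=> /forallP/(_ i)/eqP. Qed.

Definition before (k : 'I_r) f : {set E} := phi f @: [set i : 'I_r | (i < k)%N].
Definition support f : {set E} := phi f @: [set: 'I_r].
Definition nbefore (k : 'I_r) := #|[set i : 'I_r | (i < k)%N]|.
Definition nafter (k : 'I_r) := #|[set i : 'I_r | (k < i)%N]|.

Lemma nbefore_nafter k : (nbefore k + (nafter k).+1)%N = r.
Proof.
rewrite -[RHS]card_ord -cardsT -(cardsID [set i : 'I_r | (i < k)%N] [set: 'I_r]).
rewrite finset.setTI; congr (_ + _)%N.
rewrite (cardsD1 k) !inE ltnn /= add1n; congr S; apply: eq_card => i.
rewrite !inE -leqNgt andbT ltn_neqAle; congr (_ && _).
by rewrite eq_sym.
Qed.

Lemma prod_before k f G :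
  \prod_(i < r | (i < k)%N) (phi f i \in G)%:R = (before k f \subset G)%:R :> R.
Proof.
case: (boolP (_ \subset G)) => [/fintype.subsetP h|/subsetPn[x]].
  by rewrite big1// => i ik; rewrite h// imset_f// inE.
move=> /imsetP[i]; rewrite inE => ik -> iG.
by rewrite (bigD1 i)//= (negPf iG) mul0r.
Qed.

(** A pair weighs its excess probability: a factor [K / p] for each point that
    it shares beyond the [k]-th one. *)
Definition overlap_sum (k : 'I_r) : R := \sum_f \sum_(f' | phi f' k == phi f k)
  (K%:R / p) ^+ #|support f :&: support f'|.-1.

Definition exposed_degree j k tau G e : R :=
  \sum_(f | rainbow j tau f && (phi f k == e)) (before k f \subset G)%:R.

Lemma exposed_degree_sq j k tau G :
  \sum_e exposed_degree j k tau G e ^+ 2 =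
  \sum_f \sum_(f' | phi f' k == phi f k) (rainbow j tau f && rainbow j tau f')%:R *
    (before k f :|: before k f' \subset G)%:R.
Proof.
rewrite [RHS](partition_big (fun f => phi f k) xpredT)//=; apply: eq_bigr => e _.
rewrite expr2 /exposed_degree big_distrlr /=.
rewrite big_mkcondl; apply: eq_bigr => f /eqP <-.
have [rf|_] := boolP (rainbow j tau f) => /=; last first.
  by rewrite big1// => f' _; rewrite mul0r.
rewrite big_mkcondl; apply: eq_bigr => f' _.
rewrite finset.subUset; case: (rainbow j tau f') => /=; last by rewrite mul0r.
by rewrite mul1r; do 2 case: (_ \subset _); rewrite ?mulr1 ?mulr0.
Qed.

(** Each point shared beyond the [k]-th one is paid for once instead of twice,
    hence a factor [K / p] per shared point. *)
Lemma overlap_weight k f f' : phi f' k = phi f k ->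
  K%:R ^+ #|E| / K%:R ^+ #|support f :|: support f'| *
    (p ^+ #|before k f :|: before k f'| * Z) <=
  K%:R ^+ #|E| / K%:R ^+ (r + r).-1 * p ^+ (nbefore k + nbefore k) * Z *
  (K%:R / p) ^+ #|support f :&: support f'|.-1.
Proof.
move=> ff'; have /andP[p0 p1] := p01.
have KR : 0 < K%:R :> R by rewrite ltr0n.
have Z0 : 0 <= Z by apply: sumr_ge0 => G _; exact: cond_mass_nneg.
have cs f0 : #|support f0| = r by rewrite card_imset// cardsT card_ord.
have cb f0 : #|before k f0| = nbefore k by rewrite card_imset.
set a := #|support f :&: support f'|.
have hk : phi f k \in support f :&: support f'.
  by rewrite inE imset_f ?inE//= -ff' imset_f ?inE.
have a0 : (0 < a)%N by apply/card_gt0P; exists (phi f k).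
have ua : (#|support f :|: support f'| + a = r + r)%N.
  by have := cardsUI (support f) (support f'); rewrite !cs.
set b := #|before k f :&: before k f'|.
have ub : (#|before k f :|: before k f'| + b = nbefore k + nbefore k)%N.
  by have := cardsUI (before k f) (before k f'); rewrite !cb.
have ba : (b <= a.-1)%N.
  rewrite -ltnS prednK// /a (cardsD1 (phi f k)) hk add1n ltnS.
  apply: subset_leq_card; apply/fintype.subsetP => x.
  rewrite !inE => /andP[/imsetP[i]]; rewrite inE => ik -> h2.
  rewrite (inj_eq (@phi_inj f)) imset_f ?inE//=; apply/andP; split.
    by apply/eqP => ii; rewrite ii ltnn in ik.
  by move: h2; apply/fintype.subsetP/imsetS/fintype.subsetP => ?; rewrite !inE.
have -> : K%:R ^+ #|support f :|: support f'| = K%:R ^+ (r + r).-1 / K%:R ^+ a.-1 :> R.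
  have -> : ((r + r).-1 = #|support f :|: support f'| + a.-1)%N.
    by rewrite -ua; case: (a) a0 => // a' _; rewrite addnS.
  by rewrite exprD mulfK// expf_neq0// gt_eqF.
have pb : p ^+ #|before k f :|: before k f'| <=
    p ^+ (nbefore k + nbefore k) / p ^+ a.-1.
  rewrite ler_pdivlMr ?exprn_gt0// -exprD; apply: ler_wiXn2l; rewrite ?(ltW p0) ?(ltW p1)//.
  by rewrite -ub leq_add2l.
rewrite expr_div_n invf_div.
set x := p ^+ _ in pb *; set y := p ^+ _ in pb *.
have -> : K%:R ^+ #|E| / K%:R ^+ (r + r).-1 * y * Z * (K%:R ^+ a.-1 / p ^+ a.-1) =
  K%:R ^+ #|E| * (K%:R ^+ a.-1 / K%:R ^+ (r + r).-1) * ((y / p ^+ a.-1) * Z).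
  by ring.
apply: ler_wpM2l; last by rewrite ler_wpM2r.
by rewrite mulr_ge0 ?divr_ge0 ?exprn_ge0 ?ler0n.
Qed.

(** Only upper bounds on joint probabilities are needed, and those hold for
    the conditioned law by [cond_mass_subset]. *)
Lemma exposed_degree_second_moment j k :
  \sum_(tau : colouring) \sum_G m G * (\sum_e exposed_degree j k tau G e ^+ 2) <=
  K%:R ^+ #|E| / K%:R ^+ (r + r).-1 * p ^+ (nbefore k + nbefore k) * Z * overlap_sum k.
Proof.
have -> : \sum_(tau : colouring) \sum_G m G * (\sum_e exposed_degree j k tau G e ^+ 2) =
  \sum_f \sum_(f' | phi f' k == phi f k)
    (\sum_(tau : colouring) (rainbow j tau f && rainbow j tau f')%:R) *
    (\sum_G m G * (before k f :|: before k f' \subset G)%:R).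
  under eq_bigr => tau _ do under eq_bigr => G _ do rewrite exposed_degree_sq mulr_sumr.
  under eq_bigr => tau _ do rewrite exchange_big /=.
  rewrite exchange_big /=; apply: eq_bigr => f _.
  under eq_bigr => tau _ do under eq_bigr => G _ do rewrite mulr_sumr.
  under eq_bigr => tau _ do rewrite exchange_big /=.
  rewrite exchange_big /=; apply: eq_bigr => f' _.
  rewrite mulr_suml; apply: eq_bigr => tau _; rewrite mulr_sumr; apply: eq_bigr => G _.
  by rewrite mulrCA.
rewrite /overlap_sum mulr_sumr; apply: ler_sum => f _.
rewrite mulr_sumr; apply: ler_sum => f' /eqP ff'.
apply: le_trans (overlap_weight ff'); apply: ler_pM.
- by apply: sumr_ge0 => *; rewrite ler0n.
- by apply: sumr_ge0 => *; rewrite mulr_ge0 ?ler0n ?cond_mass_nneg.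
- apply: sum_colour_cylinder => // tau tau' /andP[h1 h2] /andP[h1' h2'] x.
  rewrite inE => /orP[]/imsetP[i _ ->]; apply: val_inj => /=.
    by rewrite (rainbowP i h1) (rainbowP i h1').
  by rewrite (rainbowP i h2) (rainbowP i h2').
- exact: cond_mass_subset.
Qed.

Lemma mul_le_avg_sq (lam x t : R) : 0 < lam -> x * t <= (lam * x ^+ 2 + lam^-1 * t ^+ 2) / 2.
Proof.
move=> l0; have -> : (lam * x ^+ 2 + lam^-1 * t ^+ 2) / 2 =
  x * t + lam / 2 * (x - t / lam) ^+ 2 by field; rewrite gt_eqF.
by rewrite lerDl mulr_ge0 ?sqr_ge0// divr_ge0// ltW.
Qed.

Definition stage_error j k : R := \sum_(tau : colouring) \sum_G m G *
  (\sum_(f | rainbow j tau f) (before k f \subset G)%:R *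
    `|post p A (below j tau) (phi f k) G - post p A (below (j + k) tau) (phi f k) G|).

Lemma stage_error_le j k (lam : R) : 0 < lam -> (j + r < K)%N ->
  stage_error j k <= (lam * (energy (j + r) (j + r) - energy j j) +
    lam^-1 * (K%:R ^+ #|E| / K%:R ^+ (r + r).-1 *
      p ^+ (nbefore k + nbefore k) * Z * overlap_sum k)) / 2.
Proof.
move=> l0 jrK.
have jkr : (j + k <= j + r)%N by rewrite leq_add2l ltnW.
have jkK : (j + k < K)%N by apply: leq_ltn_trans jrK.
apply: (@le_trans _ _ ((lam * (energy (j + k) (j + k) - energy j j) +
   lam^-1 * \sum_(tau : colouring) \sum_G m G * (\sum_e exposed_degree j k tau G e ^+ 2)) / 2)); last first.
  rewrite ler_pM2r ?invr_gt0// lerD//.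
    by rewrite ler_pM2l// lerD2r; apply: energy_mono; rewrite jkr.
  by rewrite ler_pM2l ?invr_gt0//; exact: exposed_degree_second_moment.
rewrite -(@energy_gap j (j + k)%N) ?leq_addr//.
rewrite !mulr_sumr -big_split mulr_suml /=; apply: ler_sum => tau _.
rewrite exchange_big /= !mulr_sumr -big_split mulr_suml /=; apply: ler_sum => G _.
rewrite -mulr_sumr !(mulrCA _ (m G)) -mulrDr -mulrA ler_wpM2l ?cond_mass_nneg//.
rewrite (partition_big (fun f => phi f k) (fun e => tau e == (j + k)%N :> nat)) /=; last first.
  by move=> f /(rainbowP k)->.
apply: (@le_trans _ _ (\sum_(e | tau e == (j + k)%N :> nat)
  (lam * (post p A (below (j + k) tau) e G - post p A (below j tau) e G) ^+ 2
   + lam^-1 * exposed_degree j k tau G e ^+ 2) / 2)).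
  apply: ler_sum => e te.
  apply: le_trans (_ : `|post p A (below (j + k) tau) e G - post p A (below j tau) e G| *
    exposed_degree j k tau G e <= _); last first.
    by rewrite -[X in lam * X]real_normK ?num_real//; exact: mul_le_avg_sq.
  rewrite mulrC mulr_suml; apply: ler_sum => f /andP[_ /eqP ->].
  by rewrite distrC.
rewrite -mulr_suml ler_pM2r ?invr_gt0// big_split /= -!mulr_sumr lerD2l.
rewrite ler_pM2l ?invr_gt0//.
by rewrite big_mkcond /=; apply: ler_sum => e _; case: ifP => // _; exact: sqr_ge0.
Qed.

Variable h : {set E} -> {set E} -> R.
Hypotheses (h_ge0 : forall W G, 0 <= h W G) (h_le1 : forall W G, h W G <= 1).
Hypothesis h_trace : forall W G G', G :&: W = G' :&: W -> h W G = h W G'.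

(** The test function [h] serves to take the positive part of an error. *)
Definition replacement_gap W f : R := \sum_G m G * (h W G *
  (\prod_i post p A W (phi f i) G - \prod_i (phi f i \in G)%:R)).

(** In the [k]-th term of the telescoping sum everything but the indicator
    of the [k]-th edge is measurable with respect to the colours below
    [j + k], so that indicator may be replaced by its posterior there. *)
Lemma rainbow_gap_le j tau f : rainbow j tau f ->
  replacement_gap (below j tau) f <= \sum_(k < r) p ^+ nafter k *
   \sum_G m G * ((before k f \subset G)%:R *
    `|post p A (below j tau) (phi f k) G - post p A (below (j + k) tau) (phi f k) G|).
Proof.
move=> rf; have /andP[p0 p1] := p01; set W := below j tau.
have out (i : 'I_r) : phi f i \notin W by rewrite inE (rainbowP i rf) -leqNgt leq_addr.
rewrite /replacement_gap.
under eq_bigr => G _ do rewrite prod_telescope 2!mulr_sumr.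
rewrite exchange_big /=; apply: ler_sum => k _; set W' := below (j + k) tau.
have WW' : W \subset W' by apply: below_mono; rewrite leq_addr.
pose tail G := \prod_(i < r | (k < i)%N) post p A W (phi f i) G.
pose H G := h W G * (before k f \subset G)%:R * tail G.
have H0 G : 0 <= H G.
  by rewrite !mulr_ge0 ?ler0n ?prodr_ge0// => i _; rewrite post_ge0.
have H1 G : H G <= p ^+ nafter k * (before k f \subset G)%:R.
  rewrite /H mulrC; apply: ler_pM; rewrite ?mulr_ge0 ?ler0n//.
  - by apply: prodr_ge0 => i _; rewrite post_ge0.
  - rewrite /tail /nafter; have -> : p ^+ #|[set i : 'I_r | (k < i)%N]| = \prod_(i < r | (k < i)%N) p.
      by rewrite prodr_const; congr (_ ^+ _); apply: eq_card => i; rewrite inE.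
    by apply: ler_prod => i _; rewrite post_ge0// post_le.
  - by rewrite -[leRHS]mul1r ler_wpM2r ?ler0n.
have HW G G' : G :&: W' = G' :&: W' -> H G = H G'.
  move=> GG'; have GW := trace_mono WW' GG'; rewrite /H (h_trace GW); congr (_ * _ * _).
    rewrite -!prod_before; apply: eq_bigr => i ik; congr (_%:R).
    have iW : phi f i \in W' by rewrite inE (rainbowP i rf) ltn_add2l.
    by have := congr1 (fun X : {set E} => phi f i \in X) GG'; rewrite !finset.in_setI iW !andbT => ->.
  by apply: eq_bigr => i _; apply: post_fibre.
have -> : \sum_G m G * (h W G * ((\prod_(i < r | (i < k)%N) (phi f i \in G)%:R) *
    (post p A W (phi f k) G - (phi f k \in G)%:R) *
    \prod_(i < r | (k < i)%N) post p A W (phi f i) G)) =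
  \sum_G m G * (H G * (post p A W (phi f k) G - post p A W' (phi f k) G)).
  have tw := @post_tower _ _ _ _ p01 W' (phi f k) H HW.
  transitivity (\sum_G m G * (H G * post p A W (phi f k) G) -
     \sum_G m G * (H G * (phi f k \in G)%:R)).
    rewrite -sumrB; apply: eq_bigr => G _; rewrite prod_before /H /tail; ring.
  by rewrite -tw -sumrB; apply: eq_bigr => G _; ring.
rewrite mulr_sumr; apply: ler_sum => G _; rewrite [leRHS]mulrCA.
rewrite ler_wpM2l ?cond_mass_nneg// mulrA.
apply: (@le_trans _ _ (H G * `|post p A W (phi f k) G - post p A W' (phi f k) G|)).
  by rewrite ler_wpM2l ?ler_norm.
by rewrite ler_wpM2r.
Qed.

Lemma rainbow_sum_le j :
  \sum_(tau : colouring) \sum_(f | rainbow j tau f) replacement_gap (below j tau) f <=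
  \sum_(k < r) p ^+ nafter k * stage_error j k.
Proof.
apply: (@le_trans _ _ (\sum_(tau : colouring) \sum_(f | rainbow j tau f) \sum_(k < r) p ^+ nafter k *
   \sum_G m G * ((before k f \subset G)%:R *
    `|post p A (below j tau) (phi f k) G - post p A (below (j + k) tau) (phi f k) G|))).
  by do 2 (apply: ler_sum => ? ?); exact: rainbow_gap_le.
under eq_bigr => tau _ do rewrite exchange_big /=.
rewrite exchange_big /= le_eqVlt; apply/orP; left; apply/eqP; apply: eq_bigr => k _.
under eq_bigr => tau _ do rewrite -mulr_sumr.
rewrite -mulr_sumr; congr (_ * _); apply: eq_bigr => tau _.
by rewrite exchange_big /=; apply: eq_bigr => G _; rewrite mulr_sumr.
Qed.

Definition avoids W f := [forall i : 'I_r, phi f i \notin W].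

(** Given the exposed set, an avoiding [f] is rainbow with probability
    [(K - j)^(- r)]. *)
Lemma sum_avoiding_rainbow j (F : {set E} -> I -> R) : (j + r < K)%N ->
  \sum_(tau : colouring) \sum_(f | avoids (below j tau) f) F (below j tau) f =
  (K - j)%:R ^+ r * \sum_(tau : colouring) \sum_(f | rainbow j tau f) F (below j tau) f.
Proof.
move=> jrK; rewrite (exchange_big_dep xpredT)//= [in RHS](exchange_big_dep xpredT)//=.
rewrite mulr_sumr; apply: eq_bigr => f _.
have jiK (i : 'I_r) : (j + i < K)%N.
  by apply: leq_ltn_trans jrK; rewrite leq_add2l ltnW.
pose s := [seq (phi f i, Ordinal (jiK i)) | i <- enum 'I_r].
have inv (tau : colouring) e (c : 'I_K) : (j <= tau e)%N -> (j <= c)%N ->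
   F (below j (recolour tau e c)) f = F (below j tau) f.
  by move=> h1 h2; rewrite below_recolour.
have us : uniq (unzip1 s).
  by rewrite /unzip1 -map_comp map_inj_uniq ?enum_uniq// => x y /= /phi_inj.
have js : all (fun x : E * 'I_K => j <= x.2)%N s.
  by apply/allP => x /mapP[i _ ->] /=; rewrite leq_addr.
have := sum_colour_prescribe inv us js; rewrite size_map size_enum_ord => hs.
transitivity (\sum_(tau : colouring | all (fun x : E * 'I_K => j <= tau x.1)%N s) F (below j tau) f).
  apply: eq_bigl => tau; apply/forallP/allP => [h1 x /mapP[i _ ->] /=|h1 i].
    by have := h1 i; rewrite inE -leqNgt.
  by rewrite inE -leqNgt; apply: (h1 (phi f i, _)); apply/mapP; exists i => //; rewrite mem_enum.
rewrite hs; congr (_ * _); apply: eq_bigl => tau.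
apply/allP/forallP => [h1 i|h1 x /mapP[i _ ->] /=]; last by have := h1 i.
by apply: (h1 (phi f i, Ordinal (jiK i))); apply/mapP; exists i => //; rewrite mem_enum.
Qed.

(** The value of [lam] balances the two terms of [stage_error_le]; the powers
    of [K] lost to rainbow colourings are recovered exactly by
    [sum_avoiding_rainbow], so they do not spoil the gain 1/B. *)
Lemma avoiding_gap_le (J B : nat) (C : R) j : 0 <= C -> (0 < #|I|)%N -> (0 < #|E|)%N ->
  (0 < B)%N -> J = (B ^ 2)%N -> (j + r < K)%N ->
  energy (j + r) (j + r) - energy j j <=
    Z * p ^+ 2 * #|E|%:R * (K%:R ^+ #|E| / K%:R) / J%:R ->
  (forall k, overlap_sum k <= C * #|I|%:R ^+ 2 / #|E|%:R) ->
  \sum_(tau : colouring) \sum_(f | avoids (below j tau) f) replacement_gap (below j tau) f <=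
  r%:R * (1 + C) / (2 * B%:R) * (K%:R ^+ #|E| * Z * #|I|%:R * p ^+ r).
Proof.
move=> C0 I0 E0 B0 JB jrK gap hC; have /andP[p0 p1] := p01.
have KR : 0 < K%:R :> R by rewrite ltr0n.
have IR : 0 < #|I|%:R :> R by rewrite ltr0n.
have ER : 0 < #|E|%:R :> R by rewrite ltr0n.
have BR : 0 < B%:R :> R by rewrite ltr0n.
have Z0 : 0 <= Z by apply: sumr_ge0 => G _; exact: cond_mass_nneg.
have stage k : p ^+ nafter k * stage_error j k <=
    (1 + C) / (2 * B%:R) * (K%:R ^+ #|E| * Z * #|I|%:R * p ^+ r) / K%:R ^+ r.
  set M := nbefore k.
  have r0 : (0 < r)%N by rewrite (leq_trans _ (ltn_ord k)).
  pose lam : R := B%:R * #|I|%:R / #|E|%:R / K%:R ^+ r.-1 * p ^+ M / p.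
  have l0 : 0 < lam by rewrite /lam !(mulr_gt0, invr_gt0, exprn_gt0).
  have := stage_error_le k l0 jrK; rewrite -/M => se.
  have up : stage_error j k <= (lam * (Z * p ^+ 2 * #|E|%:R * (K%:R ^+ #|E| / K%:R) / J%:R) +
    lam^-1 * (K%:R ^+ #|E| / K%:R ^+ (r + r).-1 * p ^+ (M + M) * Z *
    (C * #|I|%:R ^+ 2 / #|E|%:R))) / 2.
    apply: le_trans se _; rewrite ler_pM2r ?invr_gt0//.
    apply: lerD; first by rewrite ler_pM2l.
    rewrite ler_pM2l ?invr_gt0// ler_wpM2l//.
    by rewrite !mulr_ge0 ?invr_ge0 ?exprn_ge0// ltW.
  apply: le_trans (ler_wpM2l _ up) _; first by rewrite exprn_ge0// ltW.
  have pr : p ^+ r = p ^+ M * p * p ^+ nafter k.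
    by rewrite -[in LHS](nbefore_nafter k) exprD exprS mulrA.
  have Kr : K%:R ^+ r = K%:R * K%:R ^+ r.-1 :> R by rewrite -exprS prednK.
  have Krr : K%:R ^+ (r + r).-1 = K%:R * K%:R ^+ r.-1 * K%:R ^+ r.-1 :> R.
    by rewrite -Kr -exprD; congr (_ ^+ _); case: (r) r0 => // r' _; rewrite addSn addnS.
  rewrite pr Kr Krr exprD JB natrX /lam le_eqVlt; apply/orP; left; apply/eqP.
  have pM : p ^+ M != 0 by rewrite expf_neq0// gt_eqF.
  have Kk : K%:R ^+ r.-1 != 0 :> R by rewrite expf_neq0// gt_eqF.
  by field; rewrite pM Kk !gt_eqF.
rewrite sum_avoiding_rainbow//.
set RHS := (X in _ <= X).
have R0 : 0 <= RHS.
  by rewrite /RHS !mulr_ge0 ?invr_ge0 ?exprn_ge0 ?mulr_ge0 ?addr_ge0 ?ler0n// ltW.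
have main : \sum_(tau : colouring) \sum_(f | rainbow j tau f) replacement_gap (below j tau) f <=
   RHS / K%:R ^+ r.
  apply: le_trans (rainbow_sum_le j) _.
  apply: le_trans (ler_sum _ (fun k _ => stage k)) _.
  rewrite sumr_const card_ord -[leLHS]mulr_natl /RHS le_eqVlt; apply/orP; left; apply/eqP; ring.
apply: le_trans (ler_wpM2l _ main) _; first by rewrite exprn_ge0 ?ler0n.
rewrite mulrCA -[leRHS]mulr1 ler_wpM2l// ler_pdivrMr ?exprn_gt0// mul1r.
apply: lerXn2r; rewrite ?nnegrE ?ler0n// ler_nat; exact: leq_subr.
Qed.

End Exposure.

(** * A product measure extracted from the conditioned one *)

Lemma exists_le_mean (R : realFieldType) (T : finType) (m F : T -> R) :
  (forall x, 0 <= m x) -> 0 < \sum_x m x -> \sum_x m x * F x <= \sum_x m x ->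
  exists2 x, 0 < m x & F x <= 1.
Proof.
move=> m0 ms h; apply: contrapT => nx.
have F1 x : 0 < m x -> 1 < F x.
  by move=> mx; rewrite ltNge; apply/negP => Fx; apply: nx; exists x.
have [x0 mx0] : exists x, 0 < m x.
  apply: contrapT => n; move: ms; rewrite big1 ?ltxx// => x _; apply/eqP.
  rewrite eq_le m0 andbT leNgt; apply/negP => mx; by apply: n; exists x.
suff : \sum_x m x < \sum_x m x * F x by rewrite ltNge h.
rewrite (bigD1 x0)//= [ltRHS](bigD1 x0)//= ltr_leD//.
  by rewrite -{1}[m x0]mulr1 ltr_pM2l// F1.
apply: ler_sum => x _; have := m0 x; rewrite le_eqVlt => /orP[/eqP<-|mx].
  by rewrite mul0r.
by rewrite -{1}[m x]mulr1 ler_pM2l// ltW// F1.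
Qed.

Section ProductApproximation.
Context {R : realType} {E I : finType} {r K : nat}.
Variables (phi : I -> 'I_r -> E) (p : R) (A : pred {set E}).
Hypotheses (p01 : 0 < p < 1) (A_delete : forall G e, A G -> A (G :\ e)).
Hypotheses (phi_inj : forall f, injective (phi f)).
Local Notation colouring := {ffun E -> 'I_K}.
Local Notation m := (cond_mass p A).
Local Notation Z := (cond_total p A).

Lemma sum_touching_le (j : nat) : (0 < K)%N ->
  \sum_(tau : colouring) \sum_(f | ~~ avoids phi (below j tau) f) 1 <=
  #|I|%:R * r%:R * (j%:R * (K%:R ^+ #|E| / K%:R)) :> R.
Proof.
move=> K0; apply: (@le_trans _ _ (\sum_(tau : colouring) \sum_(f : I) \sum_(i < r)
   \sum_(c < j) (tau (phi f i) == c :> nat)%:R)).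
  apply: ler_sum => tau _; rewrite big_mkcond; apply: ler_sum => f _.
  case: (boolP (avoids _ _ _)) => [_|/forallPn[i]] /=.
    by do 2 (apply: sumr_ge0 => ? _).
  rewrite negbK inE => tj; rewrite (bigD1 i)//= (bigD1 (Ordinal tj))//= eqxx.
  by rewrite -addrA lerDl addr_ge0 ?sumr_ge0// => *; exact: sumr_ge0.
rewrite exchange_big /=; apply: (@le_trans _ _ (\sum_(f : I) r%:R * (j%:R * (K%:R ^+ #|E| / K%:R)))).
  apply: ler_sum => f _; rewrite exchange_big /= mulr_natl.
  rewrite -[X in _ *+ X]card_ord -sumr_const; apply: ler_sum => i _.
  rewrite exchange_big /= mulr_natl -[X in _ *+ X]card_ord -sumr_const.
  by apply: ler_sum => c _; exact: sum_colour_class_le.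
by rewrite sumr_const -[leLHS]mulr_natl mulrA.
Qed.

(** The cost bound holds in mean with constant 1 and the counting error is
    small in mean, so [(1 - eps) cost / D + error / (eps M)] has mean at most
    1, where [D] is minus the logarithm of the probability of [A]; a point
    where it is at most 1 has both properties. *)
Lemma exists_product_approximation (B Q : nat) (C eta eps : R) :
  (0 < r)%N -> (0 < #|I|)%N -> (0 < B)%N -> (0 < Q)%N -> K = (r * B ^ 2 * Q).+1 ->
  0 <= C -> (forall k, overlap_sum (K := K) phi p k <= C * #|I|%:R ^+ 2 / #|E|%:R) ->
  0 < Z -> 0 < - ln Z ->
  (forall G, A G -> \sum_f \prod_i (phi f i \in G)%:R <= eta * (#|I|%:R * p ^+ r)) ->
  0 <= eta -> 0 < eps < 1 ->
  r%:R * (1 + C) / (2 * B%:R) + r%:R / Q%:R <= eps ^+ 2 ->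
  exists q : E -> R, [/\ forall e, 0 <= q e <= 1,
    (1 - eps) * \sum_e rel_entropy p (q e) <= - ln Z &
    \sum_f \prod_i q (phi f i) <= (eta + eps) * (#|I|%:R * p ^+ r)].
Proof.
move=> r0 I0 B0 Q0 KE C0 hC Z0 D0 hA eta0 /andP[eps0 eps1] small.
have /andP[p0 p1] := p01.
have K0 : (0 < K)%N by rewrite KE.
have KR : 0 < K%:R :> R by rewrite ltr0n.
have E0 : (0 < #|E|)%N.
  have /card_gt0P[f _] := I0; apply/card_gt0P; by exists (phi f (Ordinal r0)).
have J0 : (0 < B ^ 2)%N by rewrite expn_gt0 B0.
have rJK : (r * B ^ 2 < K)%N by rewrite KE ltnS leq_pmulr.
have [j jr gap] := exists_stable_level p01 A_delete K0 J0 rJK.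
have jrK : (j + r < K)%N by apply: leq_ltn_trans rJK.
pose cnt (W G : {set E}) : R := \sum_(f | avoids phi W f) \prod_i (phi f i \in G)%:R.
pose CX (W G : {set E}) := cond_mean m (fun G' => G' :&: W) (cnt W) G.
pose pX (W G : {set E}) := \sum_(f | avoids phi W f) \prod_i post p A W (phi f i) G.
pose U (W G : {set E}) := pX W G - CX W G.
pose h (W G : {set E}) : R := (0 < U W G)%R%:R.
have U_trace W G G' : G :&: W = G' :&: W -> U W G = U W G'.
  move=> GG; rewrite /U /pX /CX (cond_mean_fibre m (cnt W) (pi := fun G' => G' :&: W) GG).
  congr (_ - _); apply: eq_bigr => f _; apply: eq_bigr => i _.
  exact: post_fibre.
have h_trace W G G' : G :&: W = G' :&: W -> h W G = h W G'.
  by move=> /U_trace; rewrite /h => ->.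
have h0 W G : 0 <= h W G by rewrite ler0n.
have h1 W G : h W G <= 1 by rewrite /h; case: (0 < _).
have hU0 W G : 0 <= h W G * U W G.
  by rewrite /h; case: ltP => [/ltW|_]; rewrite ?mul1r ?mul0r.
have hU W G : U W G <= h W G * U W G.
  by rewrite /h; case: ltP => [_|?]; rewrite ?mul1r ?mul0r.
have m0 G : 0 <= m G by exact: cond_mass_ge0.
have IR : 0 < #|I|%:R :> R by rewrite ltr0n.
have prR : 0 < p ^+ r by rewrite exprn_gt0.
pose TOT : R := K%:R ^+ #|E|.
have TOT0 : 0 < TOT by rewrite exprn_gt0.
have EU : \sum_(tau : colouring) \sum_G m G * (h (below j tau) G * U (below j tau) G) <=
    r%:R * (1 + C) / (2 * B%:R) * (TOT * Z * #|I|%:R * p ^+ r).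
  apply: le_trans (avoiding_gap_le p01 A_delete phi_inj K0 h0 h1 h_trace C0 I0 E0 B0
    (erefl _) jrK gap hC).
  rewrite le_eqVlt; apply/orP; left; apply/eqP; apply: eq_bigr => tau _.
  set W := below j tau; rewrite /replacement_gap exchange_big /=.
  transitivity (\sum_G m G * (h W G * pX W G) - \sum_G m G * (h W G * CX W G)).
    by rewrite -sumrB; apply: eq_bigr => G _; rewrite /U; ring.
  rewrite (cond_mean_tower m0); last by move=> G G'; exact: h_trace.
  rewrite -sumrB; apply: eq_bigr => G _; rewrite -mulrBr -mulrBr.
  by rewrite -!mulr_sumr -sumrB.
pose touch (tau : colouring) : R := p ^+ r * \sum_(f | ~~ avoids phi (below j tau) f) 1.
have ET : \sum_(tau : colouring) \sum_G m G * touch tau <=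
    r%:R / Q%:R * (TOT * Z * #|I|%:R * p ^+ r).
  under eq_bigr => tau _ do rewrite /touch -mulr_suml -/(cond_total p A) mulrA.
  rewrite -mulr_sumr.
  apply: le_trans (ler_wpM2l _ (sum_touching_le j K0)) _; first by rewrite mulr_ge0 ?ltW.
  have -> : Z * p ^+ r * (#|I|%:R * r%:R * (j%:R * (K%:R ^+ #|E| / K%:R))) =
    (j%:R / K%:R) * (r%:R * (TOT * Z * #|I|%:R * p ^+ r)) by rewrite /TOT; ring.
  have -> : r%:R / Q%:R * (TOT * Z * #|I|%:R * p ^+ r) =
    Q%:R^-1 * (r%:R * (TOT * Z * #|I|%:R * p ^+ r)) by ring.
  apply: ler_wpM2r; first by rewrite !mulr_ge0 ?ler0n// ltW.
  rewrite ler_pdivrMr// mulrC ler_pdivlMr ?ltr0n// -natrM ler_nat KE ltnW// ltnS.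
  by rewrite leq_mul2r (leq_trans _ jr) ?orbT// leq_addr.
have EA : \sum_(tau : colouring) \sum_G m G *
     (\sum_(e in ~: below j tau) rel_entropy p (post p A (below j tau) e G)) <=
     TOT * (Z * - ln Z).
  apply: (@le_trans _ _ (\sum_(tau : colouring) Z * - ln Z)).
    by apply: ler_sum => tau _; exact: post_entropy.
  by rewrite sumr_const card_ffun card_ord -[leLHS]mulr_natl natrX.
pose a (tau : colouring) (G : {set E}) := \sum_(e in ~: below j tau) rel_entropy p (post p A (below j tau) e G).
pose b (tau : colouring) (G : {set E}) :=
  h (below j tau) G * U (below j tau) G + touch tau.
pose D := - ln Z.
pose N := #|I|%:R * p ^+ r.
have N0 : 0 < N by rewrite mulr_gt0.
pose m2 (x : colouring * {set E}) := m x.2.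
pose F (x : colouring * {set E}) := (1 - eps) * a x.1 x.2 / D + b x.1 x.2 / (eps * N).
have m2tot : \sum_x m2 x = TOT * Z.
  rewrite /m2 -(pair_big xpredT xpredT (fun (_ : colouring) G => m G)) /=.
  by rewrite sumr_const card_ffun card_ord -[LHS]mulr_natl natrX.
have [[tau G] /= mG FG] : exists2 x, 0 < m2 x & F x <= 1.
  apply: exists_le_mean; first by move=> x; exact: m0.
    by rewrite m2tot mulr_gt0.
  rewrite m2tot -(pair_big xpredT xpredT (fun (tau : colouring) G => m2 (tau, G) * F (tau, G))) /= /m2 /F /=.
  have -> : \sum_(tau : colouring) \sum_G m G * ((1 - eps) * a tau G / D + b tau G / (eps * N)) =
    (1 - eps) / D * (\sum_(tau : colouring) \sum_G m G * a tau G) +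
    (eps * N)^-1 * (\sum_(tau : colouring) \sum_G m G * (h (below j tau) G * U (below j tau) G)
      + \sum_(tau : colouring) \sum_G m G * touch tau).
    rewrite -big_split !mulr_sumr -big_split; apply: eq_bigr => tau _ /=.
    rewrite -big_split !mulr_sumr -big_split; apply: eq_bigr => G _ /=.
    by rewrite /b; ring.
  apply: (@le_trans _ _ ((1 - eps) / D * (TOT * (Z * D)) +
    (eps * N)^-1 * (eps ^+ 2 * (TOT * Z * N)))).
    apply: lerD; first by rewrite ler_wpM2l ?divr_ge0// ?subr_ge0 ltW.
    apply: ler_wpM2l; first by rewrite invr_ge0 mulr_ge0// ltW.
    apply: le_trans (lerD EU ET) _; rewrite -mulrDl /N (mulrA (TOT * Z)).
    by rewrite ler_wpM2r// !mulr_ge0// ltW.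
  rewrite le_eqVlt; apply/orP; left; apply/eqP.
  by field; rewrite !gt_eqF.
set W := below j tau in FG *.
have pl e : e \notin W -> 0 <= post p A W e G <= p.
  by move=> eW; rewrite post_ge0//= post_le.
have aGe0 : 0 <= a tau G.
  apply: sumr_ge0 => e; rewrite inE => /pl/andP[x0 xp].
  by rewrite rel_entropy_ge0// x0 (le_trans xp)// ltW.
have bGe0 : 0 <= b tau G.
  by apply: addr_ge0 => //; rewrite /touch mulr_ge0 ?sumr_ge0// ltW.
have aD0 : 0 <= (1 - eps) * a tau G / D.
  by rewrite divr_ge0 ?mulr_ge0 ?subr_ge0// ltW.
have bN0 : 0 <= b tau G / (eps * N) by rewrite divr_ge0 ?mulr_ge0// ltW.
have aD : (1 - eps) * a tau G <= D.
  by rewrite -[leRHS]mul1r -ler_pdivrMr//; move: FG; rewrite /F /=; lra.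
have bN : b tau G <= eps * N.
  by rewrite -[leRHS]mul1r -ler_pdivrMr ?mulr_gt0//; move: FG; rewrite /F /=; lra.
pose q e := if e \in W then p else post p A W e G.
have qp e : 0 <= q e <= p.
  by rewrite /q; case: ifP => [_|/negbT/pl//]; rewrite lexx ltW.
exists q; split.
- by move=> e; have /andP[-> qe] := qp e; rewrite (le_trans qe)// ltW.
- apply: le_trans aD; rewrite ler_wpM2l ?subr_ge0 ?(ltW eps1)//.
  rewrite /a [leRHS]big_mkcond /=; apply: ler_sum => e _; rewrite inE /q.
  by case: (e \in W) => //=; rewrite rel_entropy_self.
- rewrite (bigID (avoids phi W)) /=.
  have e1 : \sum_(f | avoids phi W f) \prod_i q (phi f i) = pX W G.
    apply: eq_bigr => f /forallP av; apply: eq_bigr => i _.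
    by rewrite /q (negPf (av i)).
  have e2 : \sum_(f | ~~ avoids phi W f) \prod_i q (phi f i) <=
     touch tau.
    rewrite /touch -/W mulr_sumr; apply: ler_sum => f _; rewrite mulr1.
    rewrite -[X in p ^+ X]card_ord -prodr_const; apply: ler_prod => i _.
    exact: qp.
  have CXle : CX W G <= eta * N.
    apply: cond_mean_le; [exact: m0|by rewrite mulr_ge0// ltW|].
    rewrite /fibre_mass mulr_sumr; apply: ler_sum => G' _.
    rewrite mulrC /cond_mass; case: ifP => [AG|_]; last by rewrite !mulr0.
    rewrite ler_wpM2r ?bern_p_ge0//; apply: le_trans (hA _ AG).
    rewrite /cnt [leLHS]big_mkcond; apply: ler_sum => f _; case: ifP => // _.
    by apply: prodr_ge0 => i _; rewrite ler0n.
  have := hU W G; rewrite e1; move: bN; rewrite /b /U -/N -/W => bN hU'.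
  by move: (h W G * _) bN hU' => x bN hU'; rewrite -/N mulrDl; lra.
Qed.

End ProductApproximation.

(** * Tilting to a product measure *)

Section Tilting.
Context {R : realType} {E : finType}.
Implicit Types (q : E -> R) (p : R) (G : {set E}).

Definition log_ratio p q e (b : bool) : R :=
  if b then ln (q e / p) else ln ((1 - q e) / (1 - p)).

Lemma bern_log_ratio p q G : 0 < p < 1 -> (forall e, 0 <= q e <= p) ->
  bern q G != 0 ->
  bern q G = bern (fun=> p) G * expR (\sum_e log_ratio p q e (e \in G)).
Proof.
move=> /andP[p0 p1] hq nz.
rewrite (big_morph _ (@expRD R) (@expR0 R)) -big_split /=; apply: eq_bigr => e _.
have /andP[q0 qp] := hq e.
have : (if e \in G then q e else 1 - q e) != 0.
  by move: nz; apply: contraNN => /eqP h; rewrite /bern (bigD1 e)//= h mul0r.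
rewrite /log_ratio; case: (e \in G) => qe.
  have qe0 : 0 < q e by rewrite lt0r qe.
  by rewrite lnK ?posrE ?divr_gt0// mulrC divfK ?gt_eqF.
have pe : 0 < 1 - p by rewrite subr_gt0.
have qe1 : 0 < 1 - q e by rewrite subr_gt0 (le_lt_trans qp).
by rewrite lnK ?posrE ?divr_gt0// mulrC divfK ?gt_eqF.
Qed.

(** Chebyshev for the log-likelihood ratio: the weight
    [1 - (deviation / t)^2] is positive only where the ratio is at most
    [exp (Phi + t)], and its mean on [A] is still at least [eps / 2]. *)
Lemma neg_ln_prob_le p0 p q (A : pred {set E}) (eps t : R) :
  p0 < 1 -> 0 < p <= p0 -> (forall e, 0 <= q e <= p) -> 0 < eps -> 0 < t ->
  eps <= \sum_(G | A G) bern q G ->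
  (4 + (1 - p0)^-2) * p * #|E|%:R <= t ^+ 2 * (eps / 2) ->
  - ln (\sum_(G | A G) bern (fun=> p) G) <=
    \sum_e rel_entropy p (q e) + t + ln (2 / eps).
Proof.
move=> p01 /andP[pgt0 pp0] hq eps0 t0 QA Vt.
have p1 : p < 1 by apply: le_lt_trans p01.
set Phi := \sum_e _.
pose Y e b := log_ratio p q e b - rel_entropy p (q e).
have YE G : \sum_e Y e (e \in G) = \sum_e log_ratio p q e (e \in G) - Phi.
  by rewrite -sumrB.
have mean0 e : q e * Y e true + (1 - q e) * Y e false = 0.
  by rewrite /Y /log_ratio /rel_entropy; ring.
have var e : q e * Y e true ^+ 2 + (1 - q e) * Y e false ^+ 2 <= (4 + (1 - p0)^-2) * p.
  apply: le_trans (@log_ratio_second_moment _ p0 p (q e) p01 _ (hq e)); last by rewrite pgt0.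
  have -> : q e * Y e true ^+ 2 + (1 - q e) * Y e false ^+ 2 =
    q e * ln (q e / p) ^+ 2 + (1 - q e) * ln ((1 - q e) / (1 - p)) ^+ 2 -
    rel_entropy p (q e) ^+ 2 by rewrite /Y /log_ratio /rel_entropy; ring.
  by rewrite gerBl sqr_ge0.
have q01 e : 0 <= q e <= 1 by have /andP[-> h] := hq e; rewrite (le_trans h)// ltW.
have SM : \sum_G bern q G * (\sum_e Y e (e \in G)) ^+ 2 <= t ^+ 2 * (eps / 2).
  rewrite bern_second_moment//; apply: le_trans Vt.
  apply: le_trans (ler_sum _ (fun e _ => var e)) _.
  by rewrite sumr_const mulr_natr.
have pw G : bern q G * (1 - (\sum_e Y e (e \in G)) ^+ 2 / t ^+ 2) <=
    bern (fun=> p) G * expR (Phi + t).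
  have bp : 0 <= bern (fun=> p) G by apply: bern_ge0 => _; rewrite !ltW.
  have bq : 0 <= bern q G by exact: bern_ge0.
  have [-> | nz] := eqVneq (bern q G) 0; first by rewrite mul0r mulr_ge0// expR_ge0.
  have [le|gt] := lerP (\sum_e Y e (e \in G)) t.
    apply: (@le_trans _ _ (bern q G)).
      by rewrite -[leRHS]mulr1 ler_wpM2l// gerBl divr_ge0 ?sqr_ge0.
    rewrite (bern_log_ratio _ hq nz) ?pgt0// ler_wpM2l// ler_expR.
    by move: le; rewrite YE; lra.
  apply: (@le_trans _ _ 0); last by rewrite mulr_ge0// expR_ge0.
  rewrite mulr_ge0_le0// subr_le0 ler_pdivlMr ?exprn_gt0// mul1r.
  by rewrite ler_sqr ?nnegrE ltW// (lt_trans t0).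
have half : eps / 2 <= (\sum_(G | A G) bern (fun=> p) G) * expR (Phi + t).
  rewrite mulr_suml; apply: le_trans (ler_sum _ (fun G _ => pw G)).
  have -> : \sum_(G | A G) bern q G * (1 - (\sum_e Y e (e \in G)) ^+ 2 / t ^+ 2) =
    \sum_(G | A G) bern q G - (\sum_(G | A G) bern q G * (\sum_e Y e (e \in G)) ^+ 2) / t ^+ 2.
    by rewrite mulr_suml -sumrB; apply: eq_bigr => G _; ring.
  suff : (\sum_(G | A G) bern q G * (\sum_e Y e (e \in G)) ^+ 2) / t ^+ 2 <= eps / 2.
    by move: QA; lra.
  rewrite ler_pdivrMr ?exprn_gt0// mulrC; apply: le_trans SM.
  rewrite big_mkcond; apply: ler_sum => G _; case: ifP => // _.
  by rewrite mulr_ge0 ?sqr_ge0//; exact: bern_ge0.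
have PA : 0 < \sum_(G | A G) bern (fun=> p) G.
  have : 0 < (\sum_(G | A G) bern (fun=> p) G) * expR (Phi + t).
    by apply: lt_le_trans half; rewrite divr_gt0.
  by rewrite pmulr_lgt0// expR_gt0.
have e20 : 0 < eps / 2 by rewrite divr_gt0.
have := half; rewrite -ler_ln ?posrE ?mulr_gt0 ?expR_gt0//.
rewrite [ln (_ * expR _)]lnM ?posrE ?expR_gt0// expRK.
have -> : ln (2 / eps) = - ln (eps / 2) by rewrite -lnV ?posrE// invf_div.
lra.
Qed.

End Tilting.

Lemma one_sub_sum_le_prod (R : realDomainType) (r : nat) (x : 'I_r -> R) :
  (forall i, 0 <= x i <= 1) -> 1 - \sum_i (1 - x i) <= \prod_i x i.
Proof.
move=> hx; suff : 1 - \sum_i (1 - x i) <= \prod_i x i /\ 0 <= \prod_i x i <= 1 by case.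
elim/big_ind2 : _ => [|a1 b1 a2 b2 [h1 /andP[h2 h3]] [k1 /andP[k2 k3]]|i _].
- by rewrite subr0 lexx ler01.
- by split; [nra|apply/andP; split; nra].
- by have /andP[h1 h2] := hx i; rewrite h1 h2; split => //; lra.
Qed.

Section LowerTailCost.
Context {R : realType} {E I : finType} {r : nat}.
Variables (phi : I -> 'I_r -> E) (p : R).
Implicit Types (q : E -> R) (G : {set E}).

(** A product of numbers of [0, 1] is at least 1 minus the sum of their
    deficits, so few copies force a large total deficit of density, and the
    quadratic cost is smallest when the deficit is spread evenly. *)
Lemma entropy_ge_volume q (eps d C : R) : (0 < r)%N -> (0 < #|I|)%N -> 0 < p < 1 ->
  (forall e, 0 <= q e <= p) -> 0 < eps -> 0 < C -> 0 < d ->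
  (forall k e, #|[set f | phi f k == e]|%:R <= d) -> d * #|E|%:R <= C * #|I|%:R ->
  \sum_f \prod_i q (phi f i) <= (1 - eps) * (#|I|%:R * p ^+ r) ->
  (eps / (r%:R * C)) ^+ 2 / 4 * (p * #|E|%:R) <= \sum_e rel_entropy p (q e).
Proof.
move=> r0 I0 p01 hq eps0 C0 d0 hd dE hX; have /andP[p0 p1] := p01.
have rR : 0 < r%:R :> R by rewrite ltr0n.
pose x e := q e / p.
have x01 e : 0 <= x e <= 1.
  by have /andP[h1 h2] := hq e; rewrite divr_ge0 ?(ltW p0)//= ler_pdivrMr// mul1r.
have hx : \sum_f \prod_i x (phi f i) <= (1 - eps) * #|I|%:R.
  have -> : \sum_f \prod_i x (phi f i) = (\sum_f \prod_i q (phi f i)) / p ^+ r.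
    rewrite mulr_suml; apply: eq_bigr => f _; rewrite prodf_div.
    by rewrite prodr_const card_ord.
  by rewrite ler_pdivrMr ?exprn_gt0// -mulrA.
pose S := \sum_e (1 - x e).
have hS : eps * #|I|%:R <= r%:R * d * S.
  have : #|I|%:R - \sum_f \sum_i (1 - x (phi f i)) <= (1 - eps) * #|I|%:R.
    apply: le_trans hx; rewrite -sum1_card natr_sum -sumrB; apply: ler_sum => f _.
    exact: one_sub_sum_le_prod.
  suff : \sum_f \sum_i (1 - x (phi f i)) <= r%:R * d * S by lra.
  rewrite exchange_big /= -mulrA mulr_natl -[X in _ *+ X]card_ord -sumr_const.
  apply: ler_sum => k _.
  rewrite (partition_big (fun f => phi f k) xpredT)//= /S mulr_sumr.
  apply: ler_sum => e _.
  rewrite (eq_bigr (fun=> 1 - x e)); last by move=> f /eqP->.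
  rewrite sumr_const -[leLHS]mulr_natl; apply: ler_wpM2r.
    by have /andP[_ h] := x01 e; rewrite subr_ge0.
  by apply: le_trans (hd k e); rewrite ler_nat -cardsE.
set a := eps / (r%:R * C).
have a0 : 0 < a by rewrite divr_gt0 ?mulr_gt0.
have hS' : a * #|E|%:R <= S.
  rewrite /a mulrAC ler_pdivrMr ?mulr_gt0//.
  rewrite -(ler_pM2l d0).
  apply: (@le_trans _ _ (eps * (C * #|I|%:R))).
    by rewrite mulrCA ler_pM2l.
  rewrite mulrCA (_ : d * _ = C * (r%:R * d * S)); last by ring.
  by rewrite ler_pM2l.
apply: (@le_trans _ _ (\sum_e p / 4 * (2 * a * (1 - x e) - a ^+ 2))).
  rewrite -mulr_sumr sumrB -mulr_sumr sumr_const -[X in _ - X]mulr_natr -/S.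
  have -> : a ^+ 2 / 4 * (p * #|E|%:R) = p / 4 * (a ^+ 2 * #|E|%:R) by ring.
  rewrite ler_wpM2l ?divr_ge0 ?(ltW p0)//.
  have : a * (a * #|E|%:R) <= a * S by rewrite ler_pM2l.
  by lra.
apply: ler_sum => e _; apply: le_trans (rel_entropy_quadratic p01 (hq e)).
have -> : (p - q e) ^+ 2 / (4 * p) = p / 4 * (1 - x e) ^+ 2.
  by rewrite /x; field; rewrite gt_eqF.
rewrite ler_wpM2l ?divr_ge0 ?(ltW p0)//.
by have := sqr_ge0 (1 - x e - a); lra.
Qed.

Hypothesis phi_inj : forall f, injective (phi f).

Lemma bern_expect_count q :
  \sum_G bern q G * (\sum_f \prod_i (phi f i \in G)%:R) =
  \sum_f \prod_i q (phi f i).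
Proof.
under eq_bigr => G _ do rewrite mulr_sumr.
rewrite exchange_big /=; apply: eq_bigr => f _.
have -> : \prod_i q (phi f i) = \prod_(e in phi f @: [set: 'I_r]) q e.
  rewrite big_imset /=; last by move=> i k _ _; exact: phi_inj.
  by apply: eq_bigl => i; rewrite inE.
rewrite -bern_subset; apply: eq_bigr => G _; congr (_ * _).
case: (boolP (_ \subset G)) => [/fintype.subsetP h|/subsetPn[x]].
  by rewrite big1// => i _; rewrite h// imset_f// inE.
move=> /imsetP[i _ ->] iG.
by rewrite (bigD1 i)//= (negPf iG) mul0r.
Qed.

(** Markov's inequality; for [eta = 0] the count vanishes almost surely. *)
Lemma count_prob_ge q (eps eta M : R) : (forall e, 0 <= q e <= 1) ->
  0 <= eta -> 0 < M -> eps <= 1 ->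
  \sum_f \prod_i q (phi f i) <= (1 - eps) * (eta * M) ->
  eps <= \sum_(G : {set E} | \sum_f \prod_i (phi f i \in G)%:R <= eta * M) bern q G.
Proof.
move=> hq eta0 M0 eps1 hX.
pose X (G : {set E}) : R := \sum_f \prod_i (phi f i \in G)%:R.
have X0 G : 0 <= X G by apply: sumr_ge0 => f _; apply: prodr_ge0 => i _; rewrite ler0n.
have b0 G : 0 <= bern q G by exact: bern_ge0.
suff : \sum_(G : {set E} | ~~ (X G <= eta * M)) bern q G <= 1 - eps.
  have := bern_total q; rewrite (bigID (fun G => X G <= eta * M)) /= /X; lra.
move: hX; rewrite -bern_expect_count -/X => hX.
move: eta0; rewrite le_eqVlt => /orP[/eqP e0|eta0].
  rewrite big1 ?subr_ge0// => G; rewrite -e0 mul0r -ltNge => XG.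
  have : bern q G * X G <= 0.
    move: hX; rewrite -e0 mul0r mulr0; apply: le_trans.
    by rewrite (bigD1 G)//= lerDl; apply: sumr_ge0 => G' _; apply: mulr_ge0; [exact: b0|exact: X0].
  rewrite pmulr_lle0// => h; apply/eqP; rewrite eq_le h; exact: b0.
have N0 : 0 < eta * M by rewrite mulr_gt0.
rewrite -(ler_pM2r N0); apply: le_trans hX.
rewrite mulr_suml big_mkcond; apply: ler_sum => G _.
rewrite -ltNge; case: ltP => [/ltW h|_]; last by apply: mulr_ge0; [exact: b0|exact: X0].
by rewrite ler_wpM2l.
Qed.

(** With the deviation [t = eps Phi / 2] the error terms of [neg_ln_prob_le]
    are absorbed by [eps Phi], as [Phi] is at least a constant times [p |E|]. *)
Lemma tail_le_entropy p0 q (eps eta d C T : R) :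
  (0 < r)%N -> (0 < #|I|)%N -> p0 < 1 -> 0 < p <= p0 ->
  (forall e, 0 <= q e <= 1) -> 0 < eps <= 1 -> 0 <= eta <= 1 -> 0 < C -> 0 < d ->
  (forall k e, #|[set f | phi f k == e]|%:R <= d) -> d * #|E|%:R <= C * #|I|%:R ->
  let kappa := (eps / (r%:R * C)) ^+ 2 / 4 in
  8 * (4 + (1 - p0)^-2) <= eps ^+ 3 * kappa ^+ 2 * T ->
  2 * ln (2 / eps) <= eps * kappa * T -> T <= p * #|E|%:R ->
  \sum_f \prod_i q (phi f i) <= (1 - eps) * (eta * (#|I|%:R * p ^+ r)) ->
  - ln (\sum_(G : {set E} | \sum_f \prod_i (phi f i \in G)%:R <= eta * (#|I|%:R * p ^+ r))
        bern (fun=> p) G) <=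
  (1 + eps) * \sum_e rel_entropy p (q e).
Proof.
move=> r0 I0 p01 /andP[pgt0 pp0] hq /andP[eps0 eps1] /andP[eta0 eta1] C0 d0 hd dE.
move=> kappa T1 T2 TE hX.
have p1 : p < 1 by apply: le_lt_trans p01.
have p01' : 0 < p < 1 by rewrite pgt0.
have IR : 0 < #|I|%:R :> R by rewrite ltr0n.
have M0 : 0 < #|I|%:R * p ^+ r by rewrite mulr_gt0 ?exprn_gt0.
(* a value above p costs entropy and only adds copies *)
pose q' e := Num.min (q e) p.
have hq' e : 0 <= q' e <= p.
  by have /andP[h _] := hq e; rewrite /q' le_min h (ltW pgt0)/= ge_min lexx orbT.
have hq1 e : 0 <= q' e <= 1.
  by have /andP[-> h] := hq' e; rewrite (le_trans h)// ltW.
have cost : \sum_e rel_entropy p (q' e) <= \sum_e rel_entropy p (q e).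
  apply: ler_sum => e _; rewrite /q' minEle; case: ifP => // _.
  by rewrite rel_entropy_self// rel_entropy_ge0.
have hX' : \sum_f \prod_i q' (phi f i) <= (1 - eps) * (eta * (#|I|%:R * p ^+ r)).
  apply: le_trans hX; apply: ler_sum => f _; apply: ler_prod => i _.
  by have /andP[-> _] := hq' (phi f i); rewrite /q' ge_min lexx.
set Phi' := \sum_e rel_entropy p (q' e) in cost.
have vol : kappa * (p * #|E|%:R) <= Phi'.
  apply: (entropy_ge_volume r0 I0 p01' hq' eps0 C0 d0 hd dE).
  apply: le_trans hX' _; rewrite ler_wpM2l ?subr_ge0//.
  by rewrite -[leRHS]mul1r ler_wpM2r// ltW.
have c20 : 0 < 4 + (1 - p0)^-2 by rewrite ltr_pwDl// invr_ge0 sqr_ge0.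
set c2 := 4 + _ in T1 c20.
have k0 : 0 < kappa.
  by rewrite divr_gt0// exprn_gt0// divr_gt0// mulr_gt0// ltr0n.
clearbody kappa.
have T0 : 0 < T.
  have : 0 < eps ^+ 3 * kappa ^+ 2 * T by apply: lt_le_trans T1; rewrite mulr_gt0.
  by rewrite pmulr_rgt0// mulr_gt0// exprn_gt0.
have E0 : 0 < p * #|E|%:R by apply: lt_le_trans TE.
have Phi0 : 0 < Phi' by apply: lt_le_trans vol; rewrite mulr_gt0.
have e20 : 0 < eps * Phi' / 2 by rewrite divr_gt0 ?mulr_gt0.
have := @neg_ln_prob_le _ _ p0 p q' (fun G : {set E} => \sum_f \prod_i (phi f i \in G)%:R <=
  eta * (#|I|%:R * p ^+ r)) eps (eps * Phi' / 2) p01.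
rewrite pgt0 pp0 => /(_ isT hq' eps0 e20) main.
apply: le_trans (main _ _) _.
- exact: count_prob_ge.
- rewrite -mulrA -/c2.
  have -> : (eps * Phi' / 2) ^+ 2 * (eps / 2) = eps ^+ 3 * Phi' ^+ 2 / 8 by field.
  rewrite ler_pdivlMr// (_ : _ * 8 = 8 * c2 * (p * #|E|%:R)); last by ring.
  apply: (@le_trans _ _ (eps ^+ 3 * kappa ^+ 2 * T * (p * #|E|%:R))).
    by rewrite ler_wpM2r// ltW.
  apply: (@le_trans _ _ (eps ^+ 3 * (kappa * (p * #|E|%:R)) ^+ 2)).
    move: (p * _) TE E0 => y TE y0; rewrite -mulrA exprMn [leRHS]mulrA.
    apply: ler_wpM2l; first by rewrite mulr_ge0 ?exprn_ge0// ltW.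
    by rewrite [leRHS]expr2 ler_wpM2r// ltW.
  rewrite ler_wpM2l ?exprn_ge0 ?(ltW eps0)//.
  by rewrite ler_sqr ?nnegrE// ltW// mulr_gt0.
- have : ln (2 / eps) <= eps * Phi' / 2.
    rewrite ler_pdivlMr// mulrC; apply: le_trans T2 _.
    rewrite -mulrA ler_pM2l//; apply: le_trans vol.
    by rewrite ler_pM2l.
  have : (1 + eps) * Phi' <= (1 + eps) * \sum_e rel_entropy p (q e).
    by rewrite ler_pM2l// ltr_wpDr// ltW.
  rewrite -/Phi'; lra.
Qed.

End LowerTailCost.

(** * Embeddings and copies *)

Section Embeddings.
Context {s n : nat} {V : finType}.
Variable H : hypergraph s V.

Definition embedding := {f : {ffun V -> 'I_n} | injectiveb f}.
Implicit Types f g : embedding.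

Lemma embedding_inj f : injective (sval f).
Proof. exact/injectiveP/(svalP f). Qed.

Lemma card_edge_image f (e : edge s V) : #|sval f @: everts e| == s.
Proof. by rewrite card_imset; [exact: svalP e|exact: embedding_inj]. Qed.

Definition edge_image f (e : edge s V) : edge s 'I_n :=
  exist _ (sval f @: everts e) (card_edge_image f e).

Lemma edge_image_inj f : injective (edge_image f).
Proof.
move=> e e' /(congr1 (@everts s 'I_n)) /=.
by move=> /(imset_inj (@embedding_inj f)) h; apply: val_inj.
Qed.

Definition embedded_edge f (i : 'I_#|H|) : edge s 'I_n := edge_image f (enum_val i).

Lemma embedded_edge_inj f : injective (embedded_edge f).
Proof. by move=> i i' /edge_image_inj/enum_val_inj. Qed.

Definition embedded_copy f : {set 'I_n} * {set edge s 'I_n} :=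
  (sval f @: [set: V], [set edge_image f e | e in H]).

Definition edge_set_perms : {set {perm V}} :=
  [set sigma : {perm V} | [set sigma @: everts e | e in H] == [set everts e | e in H]].

Lemma everts_embedded_copy f :
  [set everts x | x in (embedded_copy f).2] = [set sval f @: everts e | e in H].
Proof. by rewrite /= -imset_comp. Qed.

Lemma everts_inj (T : finType) : injective (@everts s T).
Proof. exact: val_inj. Qed.

Definition precompose f (sigma : {perm V}) : embedding.
Proof.
exists [ffun x => sval f (sigma x)]; apply/injectiveP => x y.
by rewrite !ffunE => /embedding_inj/perm_inj.
Defined.

Lemma imset_precompose f sigma (A : {set V}) :
  sval (precompose f sigma) @: A = sval f @: (sigma @: A).
Proof. by rewrite -imset_comp; apply: eq_imset => x; rewrite /= ffunE. Qed.

(** The embeddings onto a given copy form a torsor under the automorphisms. *)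
Lemma card_embedded_copy_fibre f :
  #|[set g | embedded_copy g == embedded_copy f]| = #|edge_set_perms|.
Proof.
have inj : injective (precompose f).
  move=> a b /(congr1 (fun g : embedding => sval g)) /= /ffunP h; apply/permP => x.
  by have := h x; rewrite !ffunE => /embedding_inj.
have im_edges sigma : [set sval (precompose f sigma) @: everts e | e in H] =
   [set sval f @: (A : {set V}) | A in [set sigma @: everts e | e in H]].
  by rewrite -imset_comp; apply: eq_imset => e; rewrite /= -imset_precompose.
have im_edges0 : [set sval f @: everts e | e in H] =
   [set sval f @: (A : {set V}) | A in [set everts e | e in H]].
  by rewrite -imset_comp.
rewrite -(card_imset _ inj); apply: eq_card => g; rewrite inE.
apply/eqP/imsetP => [[gf1 gf2]|[sigma]].
  have ex x : exists y, sval f y == sval g x.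
    have : sval g x \in sval f @: [set: V] by rewrite -gf1 imset_f.
    by move=> /imsetP[y _ ->]; exists y.
  pose u x := xchoose (ex x).
  have uE x : sval f (u x) = sval g x by apply/eqP/(xchooseP (ex x)).
  have u_inj : injective u.
    by move=> x y uxy; apply: (@embedding_inj g); rewrite -!uE uxy.
  have gE : g = precompose f (perm u_inj).
    by apply: val_inj => /=; apply/ffunP => x; rewrite ffunE permE uE.
  exists (perm u_inj) => //; rewrite inE.
  apply/eqP/(imset_inj (imset_inj (@embedding_inj f))).
  rewrite -im_edges -gE -im_edges0 -!everts_embedded_copy.
  by rewrite /= gf2.
rewrite inE => /eqP hs ->; rewrite /embedded_copy; congr pair.
  rewrite imset_precompose (_ : sigma @: [set: V] = [set: V])//.
  apply/setP => x; rewrite !inE.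
  by apply/imsetP; exists ((sigma^-1)%g x); rewrite ?inE ?permKV.
apply: (imset_inj (@everts_inj _)).
have := everts_embedded_copy (precompose f sigma); rewrite /= => ->.
have := everts_embedded_copy f; rewrite /= => ->.
by rewrite im_edges hs -im_edges0.
Qed.

Lemma embedded_copy_sub f (G : hypergraph s 'I_n) :
  [forall i, embedded_edge f i \in G] = ((embedded_copy f).2 \subset G).
Proof.
apply/forallP/fintype.subsetP => [h _ /imsetP[e eH ->]|h i].
  by have := h (enum_rank_in eH e); rewrite /embedded_edge enum_rankK_in.
by apply: h; apply/imsetP; exists (enum_val i); rewrite ?enum_valP.
Qed.

Lemma copiesE (G : hypergraph s 'I_n) :
  copies H G = #|[set embedded_copy f | f in [pred f | [forall i, embedded_edge f i \in G]]]|.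
Proof.
apply: eq_card => F; rewrite inE; apply/idP/imsetP.
  move=> /andP[/andP[FG _] /existsP[f /and3P[fi /eqP f1 /eqP f2]]].
  pose g : embedding := exist _ f fi.
  have FE : F = embedded_copy g.
    rewrite [F]surjective_pairing /embedded_copy f1; congr pair.
    apply: (imset_inj (@everts_inj _)); rewrite f2.
    by have := everts_embedded_copy g; rewrite /= => ->.
  by exists g; rewrite // inE embedded_copy_sub -FE.
move=> [f]; rewrite inE embedded_copy_sub => fG ->.
apply/andP; split.
  rewrite /subhypergraph fG /=; apply/forallP => x; apply/implyP.
  by move=> /imsetP[e _ ->]; apply: imsetS; exact: finset.subsetT.
apply/existsP; exists (sval f); rewrite (svalP f) eqxx /=.
by have := everts_embedded_copy f; rewrite /= => ->.
Qed.

(** Counting embeddings by the copy they span. *)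
Lemma copies_embeddings (G : hypergraph s 'I_n) :
  (copies H G * #|edge_set_perms|)%N =
  #|[pred f | [forall i, embedded_edge f i \in G]]|.
Proof.
rewrite copiesE -[RHS]sum1_card (partition_big_imset embedded_copy) /=.
rewrite -sum_nat_const; apply: eq_bigr => F /imsetP[f]; rewrite inE => fG ->.
rewrite -(card_embedded_copy_fibre f) -sum1_card; apply: eq_bigl => g; rewrite !inE.
case: eqP => [E|_]; rewrite ?andbF// andbT.
by rewrite embedded_copy_sub E -embedded_copy_sub fG.
Qed.

Lemma edge_set_perms_gt0 : (0 < #|edge_set_perms|)%N.
Proof.
apply/card_gt0P; exists 1%g; rewrite inE; apply/eqP/eq_imset => e.
rewrite -[RHS]imset_id; apply: eq_imset => x; exact: perm1.
Qed.

Lemma card_confined_embeddings (U : {set V}) (D : {set 'I_n}) :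
  (#|[set f : embedding | sval f @: U \subset D]| <=
    #|D| ^ #|U| * n ^ (#|V| - #|U|))%N.
Proof.
pose Fam := family (fun x : V => if x \in U then mem D else mem 'I_n).
have -> : (#|D| ^ #|U| * n ^ (#|V| - #|U|))%N = #|Fam|.
  rewrite card_family foldrE big_map big_enum /=.
  rewrite (bigID (fun x => x \in U)) /=; congr (_ * _)%N.
    by rewrite -prod_nat_const; apply: eq_bigr => x ->.
  have -> : (#|V| - #|U|)%N = #|~: U| by rewrite [RHS]cardsCs finset.setCK.
  rewrite -prod_nat_const [LHS](eq_bigl (fun x => x \notin U)); last by move=> x; rewrite inE.
  by apply: eq_bigr => x /negbTE->; rewrite card_ord.
have -> : #|[set f : embedding | sval f @: U \subset D]| =
   #|[set sval f | f in [set f : embedding | sval f @: U \subset D]]|.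
  by rewrite card_imset//; exact: val_inj.
apply: subset_leq_card; apply/fintype.subsetP => g /imsetP[f]; rewrite inE => fU ->.
apply/familyP => x; case: ifP => // xU.
by apply: (fintype.subsetP fU); exact: imset_f.
Qed.

Lemma card_embedding : #|{: embedding}| = (n ^_ #|V|)%N.
Proof.
have := card_inj_ffuns V 'I_n; rewrite card_ord => <-.
rewrite card_sig -!sum1_card.
by apply: eq_bigl => f; rewrite !inE.
Qed.

End Embeddings.

Lemma expn_le_ffact (n v : nat) : (v <= n)%N -> (n ^ v <= v ^ v * n ^_ v)%N.
Proof.
move=> vn; rewrite ffact_prod -[X in (n ^ X)%N]card_ord -[X in (v ^ X * _)%N]card_ord.
rewrite -!prod_nat_const -big_split /=; apply: leq_prod => i _.
have := ltn_ord i; nia.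
Qed.

Lemma card_edges (s n : nat) : #|{: edge s 'I_n}| = 'C(n, s).
Proof.
have := card_draws 'I_n s; rewrite card_ord => <-.
rewrite card_sig -!sum1_card.
by apply: eq_bigl => f; rewrite !inE.
Qed.

Lemma card_edges_le (s n : nat) : (#|{: edge s 'I_n}| <= n ^ s)%N.
Proof.
rewrite card_edges; apply: (@leq_trans (n ^_ s)).
  by rewrite -bin_ffact leq_pmulr// fact_gt0.
rewrite ffact_prod -[X in (n ^ X)%N]card_ord -prod_nat_const.
by apply: leq_prod => i _; exact: leq_subr.
Qed.

Lemma card_edges_ge (s n : nat) : (s <= n)%N ->
  (n ^ s <= s ^ s * s`! * #|{: edge s 'I_n}|)%N.
Proof.
move=> /expn_le_ffact; rewrite -bin_ffact card_edges mulnA => h.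
by apply: leq_trans h _; rewrite mulnAC.
Qed.

(** * Density thresholds and counts of embeddings *)

Section Density.
Context {R : realType} {s : nat} {V : finType}.
Variable H : hypergraph s V.
Implicit Types F : {set V} * {set edge s V}.

Lemma card_everts (T : finType) (e : edge s T) : #|everts e| = s.
Proof. exact/eqP/(svalP e). Qed.

Lemma subhypergraph_verts F e : subhypergraph H F -> e \in F.2 -> everts e \subset F.1.
Proof. by move=> /andP[_ /forallP/(_ e)/implyP]; apply. Qed.

Lemma subhypergraph_card_verts F : subhypergraph H F -> (2 <= #|F.2|)%N ->
  (s < #|F.1|)%N.
Proof.
move=> FH /card_gt1P[e [e' [eF e'F ee']]].
rewrite ltnNge; apply/negP => Fs; move/negP: ee'; apply; apply/eqP/val_inj.
have eq (x : edge s V) : x \in F.2 -> everts x = F.1.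
  move=> xF; apply/eqP; rewrite eqEcard card_everts Fs andbT.
  exact: subhypergraph_verts FH xF.
exact: (etrans (eq _ eF) (esym (eq _ e'F))).
Qed.

Lemma density_ge F : subhypergraph H F -> (2 <= #|F.2|)%N ->
  (#|F.2|%:R - 1) / (#|F.1|%:R - s%:R) <= s_density R H.
Proof.
move=> FH F2; rewrite /s_density ifT; last first.
  by apply: leq_trans F2 _; apply: subset_leq_card; case/andP: FH.
apply: (le_bigmax_cond _ (fun F : {set V} * {set edge s V} =>
  (#|F.2|%:R - 1) / (#|F.1|%:R - s%:R) : R)).
by rewrite FH.
Qed.

(** Two distinct edges span at most [2 s] vertices. *)
Lemma density_geVs : (0 < s)%N -> s%:R^-1 <= s_density R H.
Proof.
move=> s0; case: (leqP 2 #|H|) => [/card_gt1P[e [e' [eH e'H ee']]]|H1]; last first.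
  by rewrite /s_density leqNgt H1.
pose F : {set V} * {set edge s V} := (everts e :|: everts e', [set e; e'])%SET.
have F2 : #|F.2| = 2 by rewrite cards2 ee'.
have FH : subhypergraph H F.
  apply/andP; split.
    by apply/fintype.subsetP => x; rewrite !inE => /orP[]/eqP->.
  apply/forallP => x; apply/implyP; rewrite !inE => /orP[]/eqP->.
    exact: finset.subsetUl.
  exact: finset.subsetUr.
have Fs := subhypergraph_card_verts FH; rewrite F2 leqnn in Fs.
apply: le_trans (density_ge FH _); rewrite F2//.
have Fle : (#|F.1| <= s + s)%N.
  have := cardsUI (everts e) (everts e'); rewrite !card_everts => <-.
  exact: leq_addr.
have d0 : 0 < #|F.1|%:R - s%:R :> R by rewrite subr_gt0 ltr_nat Fs.
have -> : (2%:R - 1 : R) = 1 by ring.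
rewrite mul1r lef_pV2 ?posrE ?ltr0n//.
by rewrite lerBlDr -natrD ler_nat.
Qed.

Lemma density_gt0 : (0 < s)%N -> 0 < s_density R H.
Proof.
by move=> s0; apply: lt_le_trans (density_geVs s0); rewrite invr_gt0 ltr0n.
Qed.

Lemma powR_threshold (mu L p : R) (n x y : nat) : 0 < mu -> 1 <= L -> (0 < n)%N ->
  (0 < x)%N -> x%:R / mu <= y%:R -> L * n%:R `^ (- mu^-1) <= p ->
  L <= p ^+ x * n%:R ^+ y.
Proof.
move=> mu0 L1 n0 x0 xy Lp.
have nR : 0 < n%:R :> R by rewrite ltr0n.
have L0 : 0 < L by apply: lt_le_trans L1.
have ny : 0 < n%:R ^+ y :> R by rewrite exprn_gt0.
rewrite -ler_pdivrMr//.
have b0 : 0 <= L * n%:R `^ (- mu^-1) by rewrite mulr_ge0 ?powR_ge0// ltW.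
apply: (@le_trans _ _ ((L * n%:R `^ (- mu^-1)) ^+ x)); last first.
  by apply: lerXn2r; rewrite ?nnegrE// (le_trans b0).
rewrite exprMn; apply: ler_pM; rewrite ?(ltW L0) ?invr_ge0 ?(ltW ny)//.
  by rewrite -[leLHS]expr1; apply: ler_weXn2l.
rewrite -[leRHS]powR_mulrn ?powR_ge0// -powRrM mulNr powRN lef_pV2 ?posrE ?powR_gt0//.
rewrite -[leRHS]powR_mulrn ?(ltW nR)//; apply: ler_powR; first by rewrite ler1n.
by rewrite mulrC.
Qed.

(** The defining property of the threshold: up to constants, the right-hand side
    is the mean number of copies of [F] that contain a given present edge. *)
Lemma density_threshold (L p : R) (n : nat) F : (0 < s)%N -> 1 <= L -> (0 < n)%N ->
  L * n%:R `^ (- (s_density R H)^-1) <= p ->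
  subhypergraph H F -> (2 <= #|F.2|)%N ->
  L <= p ^+ #|F.2|.-1 * n%:R ^+ (#|F.1| - s).
Proof.
move=> s0 L1 n0 Lp FH F2; apply: powR_threshold Lp => //; first exact: density_gt0.
  by move: F2; case: #|_| => [|[]].
have Fs := subhypergraph_card_verts FH F2.
rewrite ler_pdivrMr ?density_gt0// mulrC -ler_pdivrMr; last by rewrite ltr0n subn_gt0.
apply: le_trans (density_ge FH F2).
rewrite natrB ?(ltnW Fs)// -subn1 natrB//; exact: ltnW.
Qed.

Lemma edge_threshold (L p : R) (n : nat) : (0 < s)%N -> 1 <= L -> (0 < n)%N ->
  L * n%:R `^ (- (s_density R H)^-1) <= p -> L <= p * n%:R ^+ s.
Proof.
move=> s0 L1 n0 Lp; have := @powR_threshold (s_density R H) L p n 1 s.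
rewrite expr1; apply => //; first exact: density_gt0.
rewrite mul1r -[leRHS]invrK lef_pV2 ?posrE ?density_gt0 ?invr_gt0 ?ltr0n//.
exact: density_geVs.
Qed.

End Density.

Section CopyCounts.
Context {R : realType} {s n : nat} {V : finType}.
Variable H : hypergraph s V.
Hypotheses (sV : (s <= #|V|)%N) (s_gt0 : (0 < s)%N) (Vn : (#|V| <= n)%N).
Local Notation v := #|V|.
Local Notation phi := (@embedded_edge s n V H).
Implicit Types f g : @embedding n V.

Lemma card_confined_le (U : {set V}) (D : {set 'I_n}) : (#|D| <= v)%N ->
  (#|[set f : @embedding n V | sval f @: U \subset D]| <= v ^ v * n ^ (v - #|U|))%N.
Proof.
move=> Dv; apply: leq_trans (card_confined_embeddings _ _) _.
rewrite leq_mul2r; apply/orP; right; apply: (@leq_trans (v ^ #|U|)).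
  by case: (#|U|) => // u; rewrite leq_exp2r.
by rewrite leq_pexp2l ?max_card// (leq_trans s_gt0).
Qed.

Lemma embedding_degree_le (k : 'I_#|H|) (e : edge s 'I_n) :
  (#|[set f : @embedding n V | phi f k == e]| <= v ^ v * n ^ (v - s))%N.
Proof.
have De : (#|everts e| <= v)%N by rewrite card_everts.
have := card_confined_le (everts (enum_val k)) De; rewrite card_everts.
apply: leq_trans; apply: subset_leq_card; apply/fintype.subsetP => f.
by rewrite !inE => /eqP <-.
Qed.

Lemma card_embedding_ge : (n ^ v <= v ^ v * #|{: @embedding n V}|)%N.
Proof. by rewrite card_embedding; exact: expn_le_ffact. Qed.

(** In real terms: [n^(v - s)], the number of embeddings through a given edge
    up to a constant, is at most a constant times [|I| / |E|]. *)
Lemma embedding_density :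
  (n ^ (v - s) * #|{: edge s 'I_n}| <= v ^ v * #|{: @embedding n V}|)%N.
Proof.
apply: leq_trans card_embedding_ge.
rewrite -[X in (_ <= n ^ X)%N](subnK sV) expnD leq_mul2l card_edges_le orbT//.
Qed.

Definition edges_verts (J : {set 'I_#|H|}) : {set V} :=
  \bigcup_(i in J) everts (enum_val i).

(** Sort the embeddings [g] by the set of edges that they share with [f]: the
    vertices of these edges must land on the image of [f], which leaves a constant times
    [n^(v - v_J)] choices if they span [v_J] vertices, and the density condition
    compensates the factor [(K / p)^(|J| - 1)]. *)
Lemma overlap_sum_le (K : nat) (L p : R) (k : 'I_#|H|) :
  (0 < K)%N -> 1 <= L -> 0 < p < 1 -> (0 < n)%N ->
  L * n%:R `^ (- (s_density R H)^-1) <= p -> K%:R ^+ #|H| <= L ->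
  overlap_sum (K := K) phi p k <=
    (2 ^ #|H| * v ^ v * v ^ v)%:R * #|{: @embedding n V}|%:R ^+ 2 / #|{: edge s 'I_n}|%:R.
Proof.
move=> K0 L1 /andP[p0 p1] n0 Lp KL.
have nR : 0 < n%:R :> R by rewrite ltr0n.
have KR : 1 <= K%:R :> R by rewrite ler1n.
have ratio : 1 <= K%:R / p.
  by rewrite ler_pdivlMr// mul1r (le_trans (ltW p1)).
have r0 : 0 <= K%:R / p by apply: le_trans ratio.
pose J f g : {set 'I_#|H|} := [set i | phi g i \in support phi f].
have cardJ f g : #|support phi f :&: support phi g| = #|J f g|.
  rewrite -(card_imset _ (@embedded_edge_inj _ _ _ H g)); apply: eq_card => e.
  rewrite inE; apply/andP/imsetP => [[ef /imsetP[i _ ee]]|[i ]].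
    by exists i; rewrite // inE -ee.
  by rewrite inE => h ->; rewrite h; split => //; apply: imset_f; rewrite inE.
have piece f (J0 : {set 'I_#|H|}) : k \in J0 ->
    \sum_(g | (phi g k == phi f k) && (J f g == J0)) (K%:R / p) ^+ #|support phi f :&: support phi g|.-1
    <= (v ^ v * n ^ (v - s))%:R.
  move=> kJ.
  apply: (@le_trans _ _ (\sum_(g in [set g : @embedding n V | sval g @: edges_verts J0 \subset sval f @: [set: V]])
     (K%:R / p) ^+ #|J0|.-1)).
    rewrite big_mkcond [leRHS]big_mkcond; apply: ler_sum => g _.
    case: ifP => [/andP[_ /eqP JJ]|_]; last by case: ifP => // _; exact: exprn_ge0.
    rewrite ifT; first by rewrite cardJ JJ.
    rewrite inE; apply/fintype.subsetP => _ /imsetP[x /bigcupP[i iJ xi] ->].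
    move: iJ; rewrite -JJ inE => /imsetP[i' _ ii'].
    have : sval g x \in everts (phi f i') by rewrite -ii'; exact: imset_f.
    by move=> /imsetP[y _ ->]; exact: imset_f.
  rewrite sumr_const -[leLHS]mulr_natl.
  have Dv : (#|sval f @: [set: V]| <= v)%N.
    by rewrite card_imset ?cardsT//; exact: embedding_inj.
  have := card_confined_le (edges_verts J0) Dv; rewrite -(ler_nat R) => h.
  apply: le_trans (ler_wpM2r (exprn_ge0 _ r0) h) _.
  rewrite !natrM -mulrA ler_wpM2l ?ler0n// !natrX.
  have [J1|J2] := leqP #|J0| 1.
    have -> : J0 = [set k]%SET.
      by apply/esym/eqP; rewrite eqEcard finset.sub1set kJ cards1.
    by rewrite cards1 expr0 mulr1 /edges_verts finset.big_set1 card_everts.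
  pose F : {set V} * {set edge s V} := (edges_verts J0, [set enum_val i | i in J0])%SET.
  have F2 : #|F.2| = #|J0| by rewrite card_imset//; exact: enum_val_inj.
  have FH : subhypergraph H F.
    apply/andP; split.
      by apply/fintype.subsetP => _ /imsetP[i _ ->]; exact: enum_valP.
    apply/forallP => x; apply/implyP => /imsetP[i iJ ->].
    exact: (finset.bigcup_sup i).
  have F2' : (2 <= #|F.2|)%N by rewrite F2.
  have th := density_threshold s_gt0 L1 n0 Lp FH F2'; rewrite F2 /= in th.
  have Us := subhypergraph_card_verts FH F2'; rewrite /= in Us.
  set u := #|edges_verts J0| in th Us *.
  have uv : (u <= v)%N by exact: max_card.
  have -> : (v - s = (v - u) + (u - s))%N by rewrite addnBA ?subnK// ltnW.
  rewrite exprD ler_wpM2l ?exprn_ge0 ?(ltW nR)// expr_div_n ler_pdivrMr ?exprn_gt0//.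
  rewrite mulrC; apply: le_trans th; apply: le_trans KL.
  apply: ler_weXn2l => //; apply: (@leq_trans #|J0|); first exact: leq_pred.
  by rewrite -[leqRHS]card_ord; exact: max_card.
have E0 : (0 < #|{: edge s 'I_n}|)%N.
  by rewrite card_edges bin_gt0 (leq_trans sV).
have dens := embedding_density; rewrite -(ler_nat R) !natrM in dens.
have ER : 0 < #|{: edge s 'I_n}|%:R :> R by rewrite ltr0n.
apply: (@le_trans _ _ (\sum_(f : @embedding n V) \sum_(J0 : {set 'I_#|H|}) (v ^ v * n ^ (v - s))%:R)).
  apply: ler_sum => f _.
  rewrite (partition_big (J f) (fun J0 : {set 'I_#|H|} => k \in J0)) /=; last first.
    by move=> g /eqP gk; rewrite inE gk imset_f.
  rewrite big_mkcond; apply: ler_sum => J0 _; case: ifP => [/piece//|_].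
  exact: ler0n.
have sets : \sum_(J0 : {set 'I_#|H|}) (v ^ v * n ^ (v - s))%:R =
    (2 ^ #|H|)%:R * ((v ^ v)%:R * (n ^ (v - s))%:R) :> R.
  rewrite sumr_const -[LHS]mulr_natl natrM; congr (_%:R * _).
  by rewrite -[in RHS](card_ord #|H|) -[in RHS]cardsT -card_powerset powersetT cardsT.
rewrite sets sumr_const -[leLHS]mulr_natl ler_pdivlMr// !natrM.
have alg (N T w y M : R) : 0 <= N -> 0 <= T -> 0 <= w -> y * M <= w * N ->
    N * (T * (w * y)) * M <= T * w * w * N ^+ 2.
  move=> N0 T0 w0 h; have -> : N * (T * (w * y)) * M = N * T * w * (y * M) by ring.
  have -> : T * w * w * N ^+ 2 = N * T * w * (w * N) by ring.
  by rewrite ler_wpM2l// !mulr_ge0.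
by apply: alg; rewrite ?ler0n.
Qed.

End CopyCounts.

(** * Lower tails of the number of copies *)

Section Transfer.
Context {R : realType} {s n : nat} {V : finType}.
Variable H : hypergraph s V.
Local Notation phi := (@embedded_edge s n V H).
Local Notation N := (#|{: @embedding n V}|%:R : R).
Local Notation aut := (#|edge_set_perms H|%:R : R).

Definition embedding_count (G : hypergraph s 'I_n) : R :=
  \sum_f \prod_i (phi f i \in G)%:R.

Lemma embedding_countE (G : hypergraph s 'I_n) :
  embedding_count G = (copies H G)%:R * aut.
Proof.
rewrite -natrM copies_embeddings -[X in _ = X%:R]sum1_card natr_sum big_mkcond /=.
apply: eq_bigr => f _; rewrite inE; case: forallP => [h|/forallP/forallPn[i ni]].
  by rewrite big1// => i _; rewrite h.
by rewrite (bigD1 i)//= (negPf ni) mul0r.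
Qed.

Lemma aut_gt0 : 0 < aut. Proof. by rewrite ltr0n edge_set_perms_gt0. Qed.

Lemma mean_copiesE (q : edge s 'I_n -> R) :
  mean_copies H q * aut = \sum_f \prod_i q (phi f i).
Proof.
rewrite -bern_expect_count; last exact: embedded_edge_inj.
rewrite /mean_copies /hg_expect mulr_suml; apply: eq_bigr => G _.
by rewrite -/(embedding_count G) embedding_countE mulrA.
Qed.

Lemma mean_copies_const (p : R) :
  mean_copies H (fun _ : edge s 'I_n => p) * aut = N * p ^+ #|H|.
Proof.
rewrite mean_copiesE mulr_natl -sumr_const.
by apply: eq_bigr => f _; rewrite prodr_const card_ord.
Qed.

Lemma mean_copies_leE (q : edge s 'I_n -> R) (p x : R) :
  (mean_copies H q <= x * mean_copies H (fun _ : edge s 'I_n => p)) =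
  (\sum_f \prod_i q (phi f i) <= x * (N * p ^+ #|H|)).
Proof. by rewrite -mean_copies_const -mean_copiesE mulrA ler_pM2r ?aut_gt0. Qed.

Lemma lower_tail_probE (p x : R) :
  hg_prob (fun _ : edge s 'I_n => p)
    (fun G => (copies H G)%:R <= x * mean_copies H (fun _ : edge s 'I_n => p)) =
  \sum_(G | embedding_count G <= x * (N * p ^+ #|H|)) bern (fun=> p) G.
Proof.
apply: eq_bigl => G.
by rewrite -mean_copies_const embedding_countE mulrA ler_pM2r ?aut_gt0.
Qed.

Lemma embedding_count_delete (G : hypergraph s 'I_n) e :
  embedding_count (G :\ e) <= embedding_count G.
Proof.
apply: ler_sum => f _; apply: ler_prod => i _; rewrite ler0n ler_nat inE /=.
by case: (_ \notin _); rewrite ?andbT ?leqnn// andbF.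
Qed.

End Transfer.

Section LowerTail.
Context {R : realType} {s : nat} {V : finType}.
Variables (H : hypergraph s V) (p0 eps : R).
Hypotheses (s_gt0 : (0 < s)%N) (H_gt0 : (0 < #|H|)%N) (p0_lt1 : p0 < 1).
Hypotheses (eps_gt0 : 0 < eps) (eps_lt1 : eps < 1).
Local Notation v := #|V|.
Local Notation r := #|H|.
Local Notation phi n := (@embedded_edge s n V H).

Lemma uniformity_le_verts : (s <= v)%N.
Proof.
have /card_gt0P[e _] := H_gt0.
by rewrite -(card_everts e); exact: max_card.
Qed.

Definition deg_const : R := (v ^ v * v ^ v)%:R.
Definition cost_const : R := (eps / (r%:R * deg_const)) ^+ 2 / 4.
(** The two summands make Chebyshev's inequality effective and the additive
    error [ln (2 / eps)] negligible in [tail_le_entropy]. *)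
Definition volume_const : R :=
  8 * (4 + (1 - p0)^-2) / (eps ^+ 3 * cost_const ^+ 2) +
  2 * ln (2 / eps) / (eps * cost_const).
Definition overlap_const : R := (2 ^ r * v ^ v * v ^ v)%:R.

Lemma verts_gt0 : (0 < v)%N.
Proof. exact: leq_trans s_gt0 uniformity_le_verts. Qed.

Lemma deg_const_gt0 : 0 < deg_const.
Proof. by rewrite ltr0n muln_gt0 !expn_gt0 verts_gt0. Qed.

Lemma cost_const_gt0 : 0 < cost_const.
Proof.
by rewrite divr_gt0// exprn_gt0// divr_gt0// mulr_gt0 ?deg_const_gt0// ltr0n.
Qed.

Lemma volume_const_spec : [/\ 0 <= volume_const,
  8 * (4 + (1 - p0)^-2) <= eps ^+ 3 * cost_const ^+ 2 * volume_const &
  2 * ln (2 / eps) <= eps * cost_const * volume_const].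
Proof.
have c0 := cost_const_gt0.
set x := 8 * (4 + (1 - p0)^-2); set y := 2 * ln (2 / eps).
have x0 : 0 <= x by rewrite mulr_ge0// addr_ge0// invr_ge0 sqr_ge0.
have y0 : 0 <= y.
  by rewrite mulr_ge0// ln_ge0// ler_pdivlMr// mul1r (le_trans (ltW eps_lt1))// ler1n.
have a0 : 0 < eps ^+ 3 * cost_const ^+ 2 by rewrite mulr_gt0 ?exprn_gt0.
have b0 : 0 < eps * cost_const by rewrite mulr_gt0.
rewrite /volume_const -/x -/y; split.
- by rewrite addr_ge0// divr_ge0// ltW.
- by rewrite mulrDr mulrCA divff ?gt_eqF// mulr1 lerDl mulr_ge0 ?divr_ge0// ltW.
- by rewrite mulrDr [X in _ + X]mulrCA divff ?gt_eqF// mulr1 lerDr mulr_ge0 ?divr_ge0// ltW.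
Qed.

Lemma exists_scale (x : R) : 0 <= x -> exists2 B, (0 < B)%N & x / B%:R <= eps ^+ 2 / 2.
Proof.
move=> x0; have e2 : 0 < eps ^+ 2 / 2 by rewrite divr_gt0// exprn_gt0.
have q0 : 0 <= x / (eps ^+ 2 / 2) by rewrite divr_ge0// ltW.
have lt := archi_boundP q0; have B0 : 0 < (Num.bound (x / (eps ^+ 2 / 2)))%:R :> R.
  exact: le_lt_trans lt.
exists (Num.bound (x / (eps ^+ 2 / 2))); first by rewrite -(ltr0n R).
by rewrite ler_pdivrMr// mulrC -ler_pdivrMr// ltW.
Qed.

(** The three summands of [L] ensure [1 <= L], the bound on overlaps, and a
    large mean number of edges. *)
Lemma lower_tail_real : exists2 L : R, 0 < L &
  forall (n : nat) (p : R), (0 < n)%N -> 0 < p < 1 ->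
    L * n%:R `^ (- (s_density R H)^-1) <= p -> p <= p0 ->
  forall eta : R, 0 <= eta <= 1 ->
  let M := #|{: @embedding n V}|%:R * p ^+ r in
  let P := \sum_(G : {set edge s 'I_n} | embedding_count H G <= eta * M) bern (fun=> p) G in
  [/\ 0 < P <= 1,
    exists q : edge s 'I_n -> R, [/\ forall e, 0 <= q e <= 1,
      (1 - eps) * \sum_e rel_entropy p (q e) <= - ln P &
      \sum_f \prod_i q (phi n f i) <= (eta + eps) * M] &
    forall q : edge s 'I_n -> R, (forall e, 0 <= q e <= 1) ->
      \sum_f \prod_i q (phi n f i) <= (1 - eps) * (eta * M) ->
      - ln P <= (1 + eps) * \sum_e rel_entropy p (q e)].
Proof.
have C0 : 0 <= overlap_const by rewrite ler0n.
have rC0 : 0 <= r%:R * (1 + overlap_const) / 2.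
  by rewrite divr_ge0// mulr_ge0 ?ler0n// addr_ge0.
have [B B0 hB] := exists_scale rC0.
have [Q Q0 hQ] := exists_scale (ler0n R r).
have [K KE] : exists K, K = (r * B ^ 2 * Q).+1 by eexists.
have [vol0 vol1 vol2] := volume_const_spec.
pose w : R := (s ^ s * s`!)%:R.
have w0 : 0 < w by rewrite ltr0n muln_gt0 expn_gt0 s_gt0 fact_gt0.
have Kr0 : 0 <= K%:R ^+ r :> R by rewrite exprn_ge0 ?ler0n.
have wv0 : 0 <= w * volume_const by rewrite mulr_ge0// ltW.
exists (1 + K%:R ^+ r + w * volume_const); first by rewrite -addrA ltr_pwDl// addr_ge0.
set L := 1 + _ + _ => n p n0 p01 Lp pp0 eta /andP[eta0 eta1] M P.
have L1 : 1 <= L by rewrite /L -addrA lerDl addr_ge0.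
have KL : K%:R ^+ r <= L by rewrite /L addrAC lerDr addr_ge0.
have wL : w * volume_const <= L by rewrite /L lerDr addr_ge0.
have /andP[pgt0 plt1] := p01.
pose A (G : {set edge s 'I_n}) := embedding_count H G <= eta * M.
have bp G : 0 < bern (fun _ : edge s 'I_n => p) G.
  by apply: prodr_gt0 => e _; case: ifP => // _; rewrite subr_gt0.
have M0 : 0 <= M by apply: mulr_ge0; [exact: ler0n|apply: exprn_ge0; exact: ltW].
have etaM0 : 0 <= eta * M by exact: mulr_ge0.
have A0 : A finset.set0.
  rewrite /A; apply: le_trans etaM0; rewrite /embedding_count big1// => f _.
  by rewrite (bigD1 (Ordinal H_gt0))//= inE mul0r.
have P0 : 0 < P.
  rewrite /P (bigD1 finset.set0)//= ltr_pwDl// sumr_ge0// => G _; exact: ltW.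
have P1 : P <= 1.
  rewrite -(bern_total (fun _ : edge s 'I_n => p)) /P big_mkcond.
  by apply: ler_sum => G _; case: ifP => // _; exact: ltW.
have ent0 (q : edge s 'I_n -> R) : (forall e, 0 <= q e <= 1) -> 0 <= \sum_e rel_entropy p (q e).
  by move=> hq; apply: sumr_ge0 => e _; exact: rel_entropy_ge0.
have A_delete G e : A G -> A (G :\ e).
  by apply: le_trans; exact: embedding_count_delete.
have PE : cond_total p A = P by rewrite cond_totalE.
have [D0|D0] := leP (- ln P) 0.
  (* the event is sure, so it contains the complete hypergraph *)
  have PT : P = 1.
    apply/eqP; rewrite eq_le P1 leNgt; apply/negP => lt1.
    by move: D0; rewrite oppr_le0 leNgt ln_lt0// P0 lt1.
  have AT : A [set: edge s 'I_n].
    apply: contraT => nA; have := bern_total (fun _ : edge s 'I_n => p).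
    rewrite (bigID A) /= -/P PT; move/eqP; rewrite -[X in _ == X]addr0 (inj_eq (addrI 1)).
    by rewrite (bigD1 finset.setT)//= gt_eqF// ltr_pwDl// sumr_ge0// => G _; exact: ltW.
  have MT : M <= eta * M.
    apply: le_trans AT; rewrite /embedding_count /M mulr_natl -sumr_const.
    apply: ler_sum => f _.
    rewrite big1; last by move=> i _; rewrite inE.
    by rewrite exprn_ile1 ?ltW.
  split; first by rewrite P0.
    exists (fun=> p); split.
    - by move=> e; rewrite !ltW.
    - by rewrite big1 ?mulr0 ?PT ?ln1 ?oppr0// => e _; rewrite rel_entropy_self.
    - rewrite -mean_copiesE mean_copies_const -/M.
      by apply: le_trans MT _; rewrite ler_wpM2r// lerDl ltW.
  by move=> q hq _; apply: le_trans D0 _; rewrite mulr_ge0 ?ent0// addr_ge0// ltW.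
have I0 : (0 < #|{: @embedding n V}|)%N.
  rewrite lt0n; apply/negP => /eqP I0; move: D0; rewrite ltNge => /negP; apply.
  have -> : P = 1.
    rewrite -(bern_total (fun _ : edge s 'I_n => p)) /P; apply: eq_bigl => G.
    rewrite (le_trans _ etaM0)// /embedding_count big1// => f _.
    by have : (0 < #|{: @embedding n V}|)%N by [apply/card_gt0P; exists f]; rewrite I0.
  by rewrite ln1 oppr0.
have Vn : (v <= n)%N by move: I0; rewrite card_embedding ffact_gt0.
have sV := uniformity_le_verts.
split; first by rewrite P0.
- have small : r%:R * (1 + overlap_const) / (2 * B%:R) + r%:R / Q%:R <= eps ^+ 2.
    have -> : r%:R * (1 + overlap_const) / (2 * B%:R) = r%:R * (1 + overlap_const) / 2 / B%:R.
      by rewrite invfM mulrA.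
    by have := lerD hB hQ; rewrite -splitr.
  have ov k : overlap_sum (K := K) (phi n) p k <=
      overlap_const * #|{: @embedding n V}|%:R ^+ 2 / #|{: edge s 'I_n}|%:R.
    by apply: (overlap_sum_le sV s_gt0 Vn k _ L1 p01 n0 Lp KL); rewrite KE.
  rewrite -PE; apply: (exists_product_approximation p01 A_delete _ H_gt0 I0 B0 Q0 KE C0 ov) => //.
  + by move=> f; exact: embedded_edge_inj.
  + by rewrite PE.
  + by rewrite PE.
  + by rewrite eps_gt0.
- move=> q hq hX.
  have := @tail_le_entropy _ _ _ _ (phi n) p (@embedded_edge_inj _ _ _ H) p0 q eps eta
    (v ^ v * n ^ (v - s))%:R deg_const volume_const H_gt0 I0 p0_lt1.
  apply => //.
  + by rewrite pgt0.
  + by rewrite eps_gt0 ltW.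
  + by rewrite eta0.
  + exact: deg_const_gt0.
  + by rewrite ltr0n muln_gt0 !expn_gt0 verts_gt0 n0.
  + by move=> k e; rewrite ler_nat; exact: embedding_degree_le.
  + rewrite /deg_const -!natrM ler_nat -!mulnA leq_mul2l; apply/orP; right.
    exact: embedding_density.
  + have := edge_threshold s_gt0 L1 n0 Lp => th.
    have ge := card_edges_ge (leq_trans sV Vn); rewrite -(ler_nat R) natrM natrX in ge.
    rewrite -(ler_pM2l w0); apply: le_trans wL _; apply: le_trans th _.
    rewrite mulrCA ler_pM2l//; exact: ge.
Qed.

End LowerTail.

Theorem theorem3 (R : realType) (s : nat) (hs : (0 < s)%N) (V : finType)
    (H : hypergraph s V) (hH : (0 < #|H|)%N)
    (p0 : R) (hp0 : p0 < 1) (eps : R) (heps : 0 < eps) :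
  exists2 L : R, 0 < L &
    forall (n : nat) (p : R), (0 < n)%N -> 0 < p < 1 ->
      L * (n%:R `^ (- (s_density R H)^-1)) <= p <= p0 ->
    let X : hypergraph s 'I_n -> R := fun G => (copies H G)%:R in
    let q : edge s 'I_n -> R := fun=> p in
    forall eta : R, 0 <= eta <= 1 ->
      ((1 - eps)%:E * Phi H n p (eta + eps)
         <= - lne (hg_prob q (fun G => X G <= eta * hg_expect q X)%R)%:E)%E /\
      (- lne (hg_prob q (fun G => X G <= eta * hg_expect q X)%R)%:E
         <= (1 + eps)%:E * Phi H n p ((1 - eps) * eta)%R)%E.
Proof.
(* both bounds are monotone in eps, which may thus be taken below 1 *)
pose e := Num.min eps (2^-1).
have e0 : 0 < e by rewrite lt_min heps /= invr_gt0.
have e1 : e < 1 by rewrite gt_min invf_lt1 ?ltr0n// ltr1n orbT.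
have eeps : e <= eps by rewrite ge_min lexx.
have [L L0 main] := lower_tail_real hs hH hp0 e0 e1.
exists L => // n p n0 p01 /andP[Lp pp0] X q eta eta01.
have [/andP[P0 P1] [q1 [q101 q1S q1X]] up] := main n p n0 p01 Lp pp0 eta eta01.
have -> : hg_prob q (fun G => X G <= eta * hg_expect q X) =
    \sum_(G : {set edge s 'I_n} | embedding_count H G <=
       eta * (#|{: @embedding n V}|%:R * p ^+ #|H|)) bern (fun=> p) G.
  exact: lower_tail_probE.
set P := \sum_(G | _) _ in P0 P1 q1S up *.
rewrite lne_EFin// -EFinN.
have mp0 : 0 <= mean_copies H q.
  have /andP[pgt0 _] := p01; rewrite -(pmulr_lge0 _ (aut_gt0 H)) mean_copies_const.
  by rewrite mulr_ge0 ?ler0n// exprn_ge0// ltW.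
have D0 : 0 <= - ln P by rewrite oppr_ge0 ln_le0.
have S0 (q' : edge s 'I_n -> R) : (forall x, 0 <= q' x <= 1) -> 0 <= \sum_x rel_entropy p (q' x).
  by move=> h; apply: sumr_ge0 => x _; exact: rel_entropy_ge0.
have /andP[eta0 _] := eta01.
split.
- have q1F : feasible H n p (eta + eps) q1.
    split => //; apply: le_trans (_ : (eta + e) * mean_copies H q <= _).
      by rewrite mean_copies_leE.
    by rewrite ler_wpM2r// lerD2l.
  have PhiS : (Phi H n p (eta + eps) <= (\sum_x rel_entropy p (q1 x))%:E)%E.
    by apply: ereal_inf_lbound; exists q1.
  have Phi0 : (0 <= Phi H n p (eta + eps))%E.
    by apply: le_ereal_inf_tmp => _ [q' [h _] <-]; rewrite lee_fin; exact: S0.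
  have [le0|gt0] := leP (1 - eps) 0.
    by apply: (@le_trans _ _ 0%E); [apply: mule_le0_ge0|]; rewrite ?lee_fin.
  apply: (le_trans (lee_wpmul2l _ PhiS)); first by rewrite lee_fin ltW.
  rewrite -EFinM lee_fin; apply: le_trans q1S.
  by rewrite ler_wpM2r ?S0// lerB.
- have ep1 : 0 < 1 + eps by rewrite addr_gt0.
  rewrite muleC -lee_pdivrMr// -EFinM.
  apply: le_ereal_inf_tmp => _ [q' [h hX] <-]; rewrite lee_fin ler_pdivrMr// mulrC.
  apply: le_trans (up q' h _) _; last first.
    by rewrite ler_wpM2r ?S0// lerD2l.
  have : mean_copies H q' <= (1 - e) * eta * mean_copies H q.
    apply: le_trans hX _.
    by rewrite ler_wpM2r// ler_wpM2r// lerB.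
  by rewrite mean_copies_leE -mulrA.
Qed.
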